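(* There is an algorithm that, given an $n$-vertex graph $G$ and a branch decomposition over $V(G)$ of mm-width $k$, computes the minimum size of a dominating set of $G$ in time $8^{k}\cdot n^{O(1)}$.
   Context: A set $S\subseteq V(G)$ is a dominating set of $G$ if every vertex of $G$ is in $S$ or adjacent to a vertex of $S$. A branch decomposition over $V(G)$ is a pair $(T,\delta)$ with $T$ a tree whose vertices have degree at most $3$ and $\delta$ a bijection from the leaves of $T$ to $V(G)$; each edge of $T$ induces a partition of $V(G)$ into the two sets of vertices mapped from leaves of the two components of $T$ minus that edge. For $S\subseteq V(G)$, $\operatorname{mm}(S)$ is the size of a maximum matching in the bipartite graph with parts $S$ and $V(G)\setminus S$ formed by the edges of $G$ between them. The mm-width of $(T,\delta)$ is the maximum of $\operatorname{mm}(A)$ over all partitions $(A,B)$ induced by edges of $T$. *)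

(* Defs.v *)
From mathcomp Require Import all_boot.

Set Implicit Arguments.
Unset Strict Implicit.
Unset Printing Implicit Defensive.

Section Graph.
Variables (V : finType) (e : rel V).

Definition simple_graph : Prop := symmetric e /\ irreflexive e.

Definition degree (x : V) : nat := #|[set y | e x y]|.

(** In a simple graph the two endpoints of an edge form a [cycle] of size 2, so
    cycles in the graph-theoretic sense are the [ucycle]s of size at least 3. *)
Definition acyclic : Prop := forall c : seq V, ucycle e c -> size c <= 2.

Definition is_tree : Prop :=
  [/\ simple_graph, 0 < #|V|, (forall x y, connect e x y) & acyclic].

(** Degree 0 is allowed so that the one-vertex tree has a leaf; in a tree with at
    least two vertices the leaves are the vertices of degree 1. *)
Definition leaf (x : V) : bool := degree x <= 1.

Definition del_edge (x y : V) : rel V :=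
  [rel u v | e u v && ((u, v) != (x, y)) && ((u, v) != (y, x))].

Definition dominating (S : {set V}) : bool :=
  [forall x, (x \in S) || [exists y in S, e x y]].

(** [setT] is always dominating, so the minimum is attained. *)
Definition domination_number : nat :=
  #|[arg min_(S < [set: V] | dominating S) #|S| ]|.

(** Edges between [S] and its complement are oriented from [S] to [~: S]. *)
Definition cut_matching (S : {set V}) (M : {set V * V}) : bool :=
  [forall p in M, [&& p.1 \in S, p.2 \notin S & e p.1 p.2]] &&
  [forall p in M, forall q in M,
     (p != q) ==> (p.1 != q.1) && (p.2 != q.2)].

Definition mm (S : {set V}) : nat :=
  \max_(M : {set V * V} | cut_matching S M) #|M|.

End Graph.

Section BranchDecomposition.
Variables (V T : finType) (e : rel V) (eT : rel T).
Variable delta : {x : T | leaf eT x} -> V.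

Definition branch_decomposition : Prop :=
  [/\ is_tree eT, (forall x, degree eT x <= 3) & bijective delta].

(** The vertices of [V] at the leaves on the side of [x], once the edge [xy] of
    the tree is removed. *)
Definition side (x y : T) : {set V} :=
  [set delta l | l : {x : T | leaf eT x} & connect (del_edge eT x y) x (val l)].

(** Each edge is met in both orientations, i.e. both parts of the induced
    partition are considered; they have the same [mm]. *)
Definition mm_width : nat :=
  \max_(p : T * T | eT p.1 p.2) mm e (side p.1 p.2).

End BranchDecomposition.

(** The model of computation: first-order call-by-value functional programs (mutually recursive unary
    functions) over binary trees, as in pure Lisp with the single atom [Nil].
    The running time is the number of evaluation rules applied. With trees
    represented by pointers to immutable cells, every rule takes O(1) operations
    of a random access machine (its word size being logarithmic in the number of
    cells), so time bounds carry over to such machines up to a constant factor.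
    Conversely, a random access machine whose words have w bits is simulated
    with a polynomial in w overhead per step, its memory being a binary trie. *)

Inductive data : Type := Nil | Cons of data & data.

(** Variables are de Bruijn indices. In [ECase a b c], [b] is used when [a] is
    [Nil]; otherwise [c] is used, where indices 0 and 1 denote the left and right
    subtrees of [a]. In [ELet a b], index 0 of [b] denotes the value of [a].
    [ECall f a] applies the [f]-th function of the program. *)
Inductive expr : Type :=
| EVar of nat
| ENil
| ECons of expr & expr
| ECase of expr & expr & expr
| ELet of expr & expr
| ECall of nat & expr.

(** The [f]-th item is the body of the [f]-th function, in which index 0 denotes
    the argument; function 0 is the entry point. *)
Definition program : Type := seq expr.

(** [eval P env a v t]: in environment [env], the expression [a] evaluates to [v]
    in time [t]. *)
Inductive eval (P : program) : seq data -> expr -> data -> nat -> Prop :=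
| eval_var env i :
    eval P env (EVar i) (nth Nil env i) 1
| eval_nil env :
    eval P env ENil Nil 1
| eval_cons env a b u v s t :
    eval P env a u s -> eval P env b v t ->
    eval P env (ECons a b) (Cons u v) (s + t).+1
| eval_case_nil env a b c v s t :
    eval P env a Nil s -> eval P env b v t ->
    eval P env (ECase a b c) v (s + t).+1
| eval_case_cons env a b c u1 u2 v s t :
    eval P env a (Cons u1 u2) s -> eval P [:: u1, u2 & env] c v t ->
    eval P env (ECase a b c) v (s + t).+1
| eval_let env a b u v s t :
    eval P env a u s -> eval P (u :: env) b v t ->
    eval P env (ELet a b) v (s + t).+1
| eval_call env f a u v s t :
    eval P env a u s -> eval P [:: u] (nth ENil P f) v t ->
    eval P env (ECall f a) v (s + t).+1.

Definition runs (P : program) (input output : data) (t : nat) : Prop :=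
  eval P [:: input] (nth ENil P 0) output t.

Definition enc_bool (b : bool) : data := if b then Cons Nil Nil else Nil.

Definition enc_nat (n : nat) : data := iter n (Cons Nil) Nil.

Definition enc_seq : seq data -> data := foldr Cons Nil.

Definition enc_graph (V : finType) (e : rel V) : data :=
  enc_seq [seq enc_seq [seq enc_bool (e x y) | y <- enum V] | x <- enum V].

(** For each tree vertex in order: [Nil] if it is not a leaf, and otherwise the
    number of its associated graph vertex, tagged by a [Cons]. *)
Definition enc_leaves (V T : finType) (eT : rel T)
    (delta : {x : T | leaf eT x} -> V) : data :=
  enc_seq [seq if insub x is Some l then Cons Nil (enc_nat (enum_rank (delta l)))
               else Nil | x <- enum T].

Definition enc_instance (V T : finType) (e : rel V) (eT : rel T)
    (delta : {x : T | leaf eT x} -> V) : data :=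
  Cons (enc_graph e) (Cons (enc_graph eT) (enc_leaves delta)).

(* Main.v *)
Require Import Defs.
From mathcomp Require Import all_boot zify.

Set Implicit Arguments.
Unset Strict Implicit.
Unset Printing Implicit Defensive.

(* [all_boot] shadows the constructors [Nil] and [Cons] of [data]. *)
Import Defs.

(* For a set [A] of vertices, let the traces of [A] be the sets [N(S) \ A] with
   [S] a subset of [A]. By Koenig's theorem the cut around [A] has a vertex cover
   of size [mm A], and a trace is determined by its behaviour on the cover, so a
   cut of the decomposition has at most [2 ^ k] traces on either side (that is,
   boolean-width is at most mm-width).
   The algorithm tabulates, for a trace [X] of [A] and a trace [Y] of the
   complement of [A], the least size of a subset of [A] that has trace [X] and
   that dominates [A] with the help of [Y]. For disjoint [A1] and [A2], the table
   of their union is obtained by running through the triples of a trace of [A1],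
   a trace of [A2], and a trace of the complement of the union: [8 ^ k] triples,
   with tables stored as binary tries. The tables are merged along the edges of
   the tree, a node being merged into its only remaining neighbor.
   The programs are written in a language whose only loop is iteration over a
   list. There the running time is controlled by the lengths of the lists alone:
   polynomial ones have length at most [L], lists of traces at most [L * M] with
   [M = 2 ^ k], and the latter are nested to depth 3. *)

(** * Dominating sets across a cut *)

(** What [A1] receives from outside comes either from the chosen part of [A2] or from the remaining
    vertices. Hence a triple ([X1], [X2], [Y]) fixes the entry that is written and the two entries
    that are read, and the exponent is that of three traces. A table is sound at each of its entries
    but complete only at those [Y] that are traces. Completeness survives a join because the help
    that a part needs is again a trace of its complement. Two obstacles shape the rest. The bound
    [2 ^ k] is given for the cuts at tree edges only, whereas merging one neighbor at a time also
    gathers intermediate unions; degree at most 3 makes each of them a side of a cut, the complement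
    of one, or trivial. Moreover, paths of nodes of degree 2 can make the tree arbitrarily larger
    than the graph, so [L] involves [#|T|], and a bound in [#|V|] alone is obtained when such nodes
    are absent. *)

Section Koenig.

(** The inequality is strict so that the absence of a cover is exactly what yields a matching of
    size [t]. *)
Definition has_cover (A B : finType) (E : {set A * B}) (t : nat) : bool :=
  [exists X : {set A}, exists Y : {set B},
     (#|X| + #|Y| < t) && [forall p in E, (p.1 \in X) || (p.2 \in Y)]].

Lemma has_coverP (A B : finType) (E : {set A * B}) t :
  reflect (exists (X : {set A}) (Y : {set B}), #|X| + #|Y| < t /\
             forall a b, (a, b) \in E -> (a \in X) || (b \in Y))
          (has_cover E t).
Proof.
apply: (iffP existsP) => [[X /existsP[Y /andP[lt /forall_inP H]]]|[X [Y [lt H]]]].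
  by exists X, Y; split=> // a b /H.
exists X; apply/existsP; exists Y; rewrite lt; apply/forall_inP=> -[a b]; exact: H.
Qed.

Lemma critical_inj (A B : finType) (E : {set A * B}) t :
  ~~ has_cover E t -> (forall p, p \in E -> has_cover (E :\ p) t) ->
  {in E &, injective fst}.
Proof.
move=> nE cE [x y] [x' z] Ey Ez /= exx; rewrite -{x'}exx in Ez *.
apply: contraNeq nE; rewrite xpair_eqE eqxx /= => yz.
have /has_coverP[X1 [Y1 [lt1 H1]]] := cE _ Ey.
have /has_coverP[X2 [Y2 [lt2 H2]]] := cE _ Ez.
have zy : (x, z) != (x, y) by rewrite xpair_eqE eqxx /= eq_sym.
have yz' : (x, y) != (x, z) by rewrite xpair_eqE eqxx.
have {}H1 a b : (a, b) \in E -> (a, b) != (x, y) -> (a \in X1) || (b \in Y1).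
  by move=> Eab nab; apply: H1; rewrite !inE nab.
have {}H2 a b : (a, b) \in E -> (a, b) != (x, z) -> (a \in X2) || (b \in Y2).
  by move=> Eab nab; apply: H2; rewrite !inE nab.
(* A cover of the relation without [(x, y)] that contains [x] covers [(x, y)] too. Otherwise the
   pair [(x, z)] forces [z] into [Y1]; likewise for the other cover. *)
have [xX1|xX1] := boolP (x \in X1).
  apply/has_coverP; exists X1, Y1; split=> // a b Eab.
  by have [[-> _]|] := eqVneq (a, b) (x, y); [rewrite xX1|apply: H1].
have [xX2|xX2] := boolP (x \in X2).
  apply/has_coverP; exists X2, Y2; split=> // a b Eab.
  by have [[-> _]|] := eqVneq (a, b) (x, z); [rewrite xX2|apply: H2].
have zY1 : z \in Y1 by move: (H1 _ _ Ez zy); rewrite (negPf xX1).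
have yY2 : y \in Y2 by move: (H2 _ _ Ey yz'); rewrite (negPf xX2).
have cX := cardsUI X1 X2; have cY := cardsUI Y1 Y2.
(* The two uncrossed pairs, before [x] is added, have total size at most [2 * (t - 1)]. If the first
   has size at least [t], the second has at most [t - 2], which leaves room for [x]. *)
have [lt|ge] := ltnP (#|X1 :&: X2| + #|Y1 :|: Y2|) t.
  apply/has_coverP; exists (X1 :&: X2), (Y1 :|: Y2); split=> // a b Eab.
  rewrite !inE; have [[_ ->]|ny] := eqVneq (a, b) (x, y).
    by rewrite yY2 !orbT.
  have [[_ ->]|nz] := eqVneq (a, b) (x, z); first by rewrite zY1 !orbT.
  by case/orP: (H1 _ _ Eab ny) => ->; case/orP: (H2 _ _ Eab nz) => ->; rewrite ?orbT.
apply/has_coverP; exists (x |: (X1 :|: X2)), (Y1 :&: Y2); split=> [|a b Eab].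
  have := cardsU1 x (X1 :|: X2); rewrite !inE negb_or xX1 xX2 /=.
  by clear -cX cY lt1 lt2 ge => ->; lia.
rewrite !inE; have [[-> _]|ny] := eqVneq (a, b) (x, y); first by rewrite eqxx.
have [[-> _]|nz] := eqVneq (a, b) (x, z); first by rewrite eqxx.
by case/orP: (H1 _ _ Eab ny) => ->; case/orP: (H2 _ _ Eab nz) => ->; rewrite ?orbT.
Qed.

Lemma has_cover_swap (A B : finType) (E : {set A * B}) t :
  has_cover [set (p.2, p.1) | p in E] t = has_cover E t.
Proof.
apply/has_coverP/has_coverP=> -[X [Y [lt H]]]; exists Y, X; rewrite addnC; split=> //.
  by move=> a b Eab; rewrite orbC; apply: H; apply/imsetP; exists (a, b).
by move=> b a /imsetP[[a' b'] Eab [-> ->]]; rewrite orbC; apply: H.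
Qed.

(* Deleting pairs as long as no cover of size less than [t] appears, one ends
   with a minimal relation with this property, and such a relation is a matching:
   if [(x, y)] and [(x, z)] are both in it, the covers [(X1, Y1)] and [(X2, Y2)]
   of the relation without the one or the other are uncrossed into
   [(X1 :&: X2, Y1 :|: Y2)] and [(x |: (X1 :|: X2), Y1 :&: Y2)]. *)
Theorem koenig (A B : finType) (E : {set A * B}) t : ~~ has_cover E t ->
  exists M : {set A * B}, [/\ M \subset E, t <= #|M|,
    {in M &, injective fst} & {in M &, injective snd}].
Proof.
have [n] := ubnP #|E|; elim: n E => // n IHn E ltEn nE.
have [/existsP[p /andP[Ep np]]|] := boolP [exists p in E, ~~ has_cover (E :\ p) t].
  have [|M [sM tM i1 i2]] := IHn _ _ np.
    by have := cardsD1 p E; rewrite Ep; lia.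
  by exists M; split=> //; apply: subset_trans sM (subsetDl _ _).
rewrite negb_exists => /forallP cE.
have {}cE p : p \in E -> has_cover (E :\ p) t.
  by move=> Ep; have := cE p; rewrite Ep negbK.
have i1 := critical_inj nE cE; exists E; split=> //.
  rewrite leqNgt; apply: contra nE => ltE; apply/has_coverP.
  exists (fst @: E), set0; rewrite cards0 addn0; split.
    exact: leq_ltn_trans (leq_imset_card _ _) ltE.
  by move=> a b Eab; apply/orP; left; apply/imsetP; exists (a, b).
(* Injectivity of [snd] is [critical_inj] for the transposed relation, which is minimal as well. *)
pose sw (p : A * B) := (p.2, p.1).
have swI : injective sw by move=> [a b] [a' b'] [-> ->].
move=> p q Ep Eq epq; apply: (swI).
apply: (@critical_inj _ _ (sw @: E) t) => //; rewrite ?has_cover_swap ?imset_f //.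
move=> r /imsetP[{}r Er ->].
have -> : sw @: E :\ sw r = sw @: (E :\ r); last by rewrite has_cover_swap cE.
apply/setP=> s; rewrite !inE; apply/andP/imsetP.
  case=> ns /imsetP[u Eu eu]; exists u => //; rewrite !inE Eu andbT.
  by apply: contraNneq ns => <-; rewrite eu.
case=> u; rewrite !inE => /andP[nu Eu] ->; split; last exact: imset_f.
by rewrite (inj_eq swI).
Qed.

End Koenig.

Section Neighborhoods.
Variables (V : finType) (e : rel V).
Hypothesis e_sym : symmetric e.

Definition nbh (x : V) : {set V} := [set y | e x y].
Definition nbhs (S : {set V}) : {set V} := \bigcup_(x in S) nbh x.

Lemma nbhsP (S : {set V}) y : reflect (exists2 x, x \in S & e x y) (y \in nbhs S).
Proof.
by apply: (iffP bigcupP) => -[x xS exy]; exists x => //; move: exy; rewrite inE.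
Qed.

Lemma nbhsU S1 S2 : nbhs (S1 :|: S2) = nbhs S1 :|: nbhs S2.
Proof. exact: bigcup_setU. Qed.

Lemma nbhs0 : nbhs set0 = set0.
Proof. exact: big_set0. Qed.

Lemma nbhs1 x : nbhs [set x] = nbh x.
Proof. exact: big_set1. Qed.

Definition traces (A : {set V}) : {set {set V}} := [set nbhs S :\: A | S in powerset A].

Lemma tracesP (A X : {set V}) :
  reflect (exists2 S : {set V}, S \subset A & X = nbhs S :\: A) (X \in traces A).
Proof.
by apply: (iffP imsetP) => -[S sS ->]; exists S => //; move: sS; rewrite inE.
Qed.

Lemma traces_set0 : traces set0 = [set set0].
Proof.
apply/setP=> X; rewrite inE; apply/tracesP/eqP=> [[S]|->].
  by rewrite subset0 => /eqP-> ->; rewrite nbhs0 set0D.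
by exists set0; rewrite ?sub0set ?nbhs0 ?set0D.
Qed.

Lemma traces_setT : traces setT = [set set0].
Proof.
apply/setP=> X; rewrite inE; apply/tracesP/eqP=> [[S _ ->]|->].
  by rewrite setDT.
by exists set0; rewrite ?sub0set ?setDT.
Qed.

(* With a cover [(X, Y)] of the cut, the trace of [S] is determined by
   [S :&: X] and by which vertices of [Y] it contains. *)
Lemma card_traces_cover (A X Y : {set V}) :
  (forall a b, a \in A -> b \notin A -> e a b -> (a \in X) || (b \in Y)) ->
  #|traces A| <= 2 ^ (#|X| + #|Y|).
Proof.
move=> cov; rewrite expnD -!card_powerset -cardsX.
apply: leq_trans (leq_imset_card (fun p => (nbhs p.1 :\: A) :|: p.2) _).
apply/subset_leq_card/subsetP=> Z /tracesP[S sS ->].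
apply/imsetP; exists (S :&: X, nbhs S :&: Y :\: A) => /=.
  by rewrite !inE subsetIr -setIDAC subsetIr.
apply/setP=> b; rewrite !inE; have [//|nb] /= := boolP (b \in A).
apply/idP/orP=> [bS|[/nbhsP[a]|/andP[]//]].
  have [bY|nY] := boolP (b \in Y); [by right; rewrite bS|left].
  case/nbhsP: bS => a aS eab; apply/nbhsP; exists a => //.
  by have := cov _ _ (subsetP sS _ aS) nb eab; rewrite inE aS (negPf nY) orbF.
by rewrite inE => /andP[aS _] eab; apply/nbhsP; exists a.
Qed.

Definition narrow (k : nat) (A : {set V}) : bool :=
  (#|traces A| <= 2 ^ k) && (#|traces (~: A)| <= 2 ^ k).

Lemma narrowC k A : narrow k (~: A) = narrow k A.
Proof. by rewrite /narrow setCK andbC. Qed.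

Lemma narrow0 k : narrow k set0.
Proof. by rewrite /narrow setC0 traces_set0 traces_setT cards1 expn_gt0. Qed.

Lemma narrow_mm k A : mm e A <= k -> narrow k A.
Proof.
move=> mmA; pose E := [set p : V * V | [&& p.1 \in A, p.2 \notin A & e p.1 p.2]].
(* Without a cover of at most [mm e A] vertices, [koenig] would give a matching with [mm e A + 1]
   edges. *)
have /has_coverP[X [Y [ltXY cov]]] : has_cover E (mm e A).+1.
  apply: contraT => /koenig[M [sM ltM i1 i2]]; move: ltM; rewrite ltnNge.
  suff -> : #|M| <= mm e A by [].
  rewrite (@leq_bigmax_cond _ _ (fun M : {set V * V} => #|M|)) //.
  apply/andP; split; apply/forall_inP=> p Mp; first by have := subsetP sM _ Mp; rewrite inE.
  apply/forall_inP=> q Mq; apply/implyP=> npq.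
  by rewrite (contra_neq (i1 _ _ Mp Mq) npq) (contra_neq (i2 _ _ Mp Mq) npq).
have leXY : #|X| + #|Y| <= k by lia.
have {}cov a b : a \in A -> b \notin A -> e a b -> (a \in X) || (b \in Y).
  by move=> aA bA eab; apply: cov; rewrite inE /= aA bA.
rewrite /narrow; apply/andP; split.
  by apply: leq_trans (card_traces_cover cov) _; rewrite leq_exp2l.
(* The same cover with its sides exchanged serves the complement of [A]. *)
apply: leq_trans (@card_traces_cover _ Y X _) _; last by rewrite addnC leq_exp2l.
by move=> b a; rewrite !inE negbK e_sym orbC => bA aA; apply: cov.
Qed.

(** * Tables of partial solutions: initialization, join, and the final answer *)

Definition table : Type := {set V} -> {set V} -> option nat.

(* [f X Y] is the least size of a subset [S] of [A] whose neighbors outside of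
   [A] are [X] and which, together with [Y], dominates [A]; only the [Y] that are
   the neighbors in [A] of some set outside of [A] matter. *)
Definition table_ok (A : {set V}) (f : table) : Prop :=
  (forall X Y m, f X Y = Some m -> exists S : {set V},
     [/\ S \subset A, #|S| = m, nbhs S :\: A = X & A \subset S :|: nbhs S :|: Y]) /\
  (forall S Y : {set V}, S \subset A -> Y \in traces (~: A) ->
     A \subset S :|: nbhs S :|: Y ->
     exists2 m, f (nbhs S :\: A) Y = Some m & m <= #|S|).

Definition update (f : table) (X Y : {set V}) (m : nat) : table := fun X' Y' =>
  if (X' == X) && (Y' == Y) then
    Some (if f X Y is Some m0 then if m <= m0 then m else m0 else m)
  else f X' Y'.

Definition update_opt (f : table) (X Y : {set V}) (o : option nat) : table :=
  if o is Some m then update f X Y m else f.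

Section Updates.
Variables (K : eqType) (kX kY : K -> {set V}) (kv : K -> option nat).

(** The common shape of the initial table and of the join, so that soundness and completeness are
    proved once. Nested loops are brought to this shape by [foldr_allpairs]. *)
Definition updates (f : table) (s : seq K) : table :=
  foldr (fun x f => update_opt f (kX x) (kY x) (kv x)) f s.

Lemma updates_sound f s X Y m : updates f s X Y = Some m ->
  f X Y = Some m \/
  exists x, [/\ x \in s, X = kX x, Y = kY x & kv x = Some m].
Proof.
elim: s m => [|x s IHs] m /=; first by left.
have IH' m' : updates f s X Y = Some m' -> f X Y = Some m' \/
    exists y, [/\ y \in x :: s, X = kX y, Y = kY y & kv y = Some m'].
  case/IHs=> [|[y [ys ? ? ?]]]; first by left.
  by right; exists y; rewrite inE ys orbT.
rewrite /update_opt; case kx: (kv x) => [m1|]; last exact: IH'.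
rewrite /update; case: andP => [[/eqP eX /eqP eY]|_]; last exact: IH'.
rewrite -eX -eY; case fm0: (updates f s X Y) => [m0|] [<-]; last first.
  by right; exists x; rewrite inE eqxx.
case: ifP => _; last exact: IH'.
by right; exists x; rewrite inE eqxx.
Qed.

Lemma updates_complete f s x m : x \in s -> kv x = Some m ->
  exists2 m', updates f s (kX x) (kY x) = Some m' & m' <= m.
Proof.
move=> xs kx; elim: s xs => //= y s IHs; rewrite inE.
case: eqVneq => [<- _|_ /= /IHs[m0 em0 lem0]].
  rewrite kx /= /update !eqxx /=; eexists; first by [].
  by case: (updates f s _ _) => // m0; case: ifP => // /negbT; lia.
rewrite /update_opt; case: (kv y) => [m1|]; last by exists m0.
rewrite /update; case: andP => [[/eqP eX /eqP eY]|_]; last by exists m0.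
rewrite -eX -eY em0; eexists; first by [].
by have [h|//] := leqP m1 m0; apply: leq_trans h lem0.
Qed.

End Updates.

Lemma foldr_allpairs (S1 S2 Z : Type) (h : S1 -> S2 -> Z -> Z) z s t :
  foldr (fun x a => foldr (fun y a => h x y a) a t) z s =
  foldr (fun p a => h p.1 p.2 a) z [seq (x, y) | x <- s, y <- t].
Proof. by elim: s => //= x s ->; rewrite foldr_cat foldr_map. Qed.

Definition no_table : table := fun _ _ => None.

Definition init_table (A : {set V}) (LB : seq {set V}) : table :=
  foldr (fun Y f =>
    foldr (fun x f => if x \in A then update f (nbh x :\: A) Y 1 else f)
      (if A \subset Y then update f set0 Y 0 else f) (enum V)) no_table LB.

(** [None] stands for the empty subset and [Some x] for the singleton of [x]. As [foldr] starts from
    the end, [None] comes last to match the initial value of the inner fold of [init_table]. *)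
Definition init_keys (LB : seq {set V}) : seq ({set V} * option V) :=
  [seq (Y, o) | Y <- LB, o <- [seq Some x | x <- enum V] ++ [:: None]].

Definition init_X (A : {set V}) (p : {set V} * option V) : {set V} :=
  if p.2 is Some x then nbh x :\: A else set0.

Definition init_v (A : {set V}) (p : {set V} * option V) : option nat :=
  if p.2 is Some x then if x \in A then Some 1 else None
  else if A \subset p.1 then Some 0 else None.

Lemma init_tableE A LB :
  init_table A LB = updates (init_X A) fst (init_v A) no_table (init_keys LB).
Proof.
rewrite /updates /init_keys.
rewrite -(@foldr_allpairs _ _ _ (fun Y o f =>
  update_opt f (init_X A (Y, o)) Y (init_v A (Y, o)))).
rewrite /init_table; elim: LB => //= Y LB ->.
rewrite foldr_cat foldr_map /=; set f := foldr _ no_table LB.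
rewrite {2}/init_X {2}/init_v /=.
have -> : update_opt f set0 Y (if A \subset Y then Some 0 else None) =
  (if A \subset Y then update f set0 Y 0 else f) by case: ifP.
by elim: (enum V) => //= x s ->; rewrite /init_X /init_v /=; case: ifP.
Qed.

(** A set with at most one element has no other subsets than the empty one and itself. The latter
    dominates [A] whatever [Y] is; the former does so exactly if [Y] contains [A]. *)
Lemma init_table_ok (A : {set V}) (LB : seq {set V}) : #|A| <= 1 -> LB =i traces (~: A) ->
  table_ok A (init_table A LB).
Proof.
move=> A1 eLB; rewrite init_tableE; split=> [X Y m|S Y sS tY dS].
  case/updates_sound=> // -[[Z [x|]] []]; rewrite /init_X /init_v /= => _ -> ->.
    case: ifP => // xA [<-]; exists [set x].
    have eA : A = [set x].
      by apply/eqP; rewrite eq_sym eqEcard sub1set xA cards1.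
    by rewrite nbhs1 cards1 sub1set xA -setUA {3}eA subsetUl.
  case: ifP => // AZ [<-]; exists set0.
  by rewrite sub0set cards0 nbhs0 set0D !set0U.
have key (o : option V) : (Y, o) \in init_keys LB.
  rewrite /init_keys allpairs_f ?eLB // mem_cat.
  by case: o => [x|]; rewrite ?inE ?orbT // map_f ?mem_enum.
have [S0|[x xS]] := set_0Vmem S.
  have AY : A \subset Y by move: dS; rewrite S0 nbhs0 !set0U.
  have kv : init_v A (Y, None) = Some 0 by rewrite /init_v /= AY.
  have [m em lem] := updates_complete (init_X A) fst no_table (key None) kv.
  by exists m; rewrite S0 ?nbhs0 ?set0D ?cards0.
have eS : S = [set x].
  apply/eqP; rewrite eq_sym eqEcard sub1set xS cards1.
  exact: leq_trans (subset_leq_card sS) A1.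
have kv : init_v A (Y, Some x) = Some 1 by rewrite /init_v /= (subsetP sS).
have [m em lem] := updates_complete (init_X A) fst no_table (key (Some x)) kv.
by exists m; rewrite eS ?nbhs1 ?cards1.
Qed.

Definition addo (o1 o2 : option nat) : option nat :=
  if o1 is Some m1 then if o2 is Some m2 then Some (m1 + m2) else None else None.

Definition join_X (A : {set V}) (X1 X2 : {set V}) := (X1 :|: X2) :\: A.
(** The help for [A1] comes from the subset chosen in [A2], which reaches [X2], and from outside of
    the union, which reaches [Y]; symmetrically for [A2]. *)
Definition join_v (A1 A2 : {set V}) (f1 f2 : table) (X1 X2 Y : {set V}) : option nat :=
  addo (f1 X1 ((X2 :|: Y) :&: A1)) (f2 X2 ((X1 :|: Y) :&: A2)).

Definition join_table (A1 A2 : {set V}) (f1 f2 : table) (L1 L2 LB : seq {set V}) : table :=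
  foldr (fun X1 f => foldr (fun X2 f => foldr (fun Y f =>
    update_opt f (join_X (A1 :|: A2) X1 X2) Y (join_v A1 A2 f1 f2 X1 X2 Y))
      f LB) f L2) no_table L1.

Lemma join_tableE A1 A2 f1 f2 L1 L2 LB :
  join_table A1 A2 f1 f2 L1 L2 LB =
  updates (fun p => join_X (A1 :|: A2) p.1.1 p.1.2) snd
    (fun p => join_v A1 A2 f1 f2 p.1.1 p.1.2 p.2) no_table
    [seq (p, Y) | p <- [seq (X1, X2) | X1 <- L1, X2 <- L2], Y <- LB].
Proof.
rewrite /updates -(@foldr_allpairs _ _ _ (fun p Y f =>
  update_opt f (join_X (A1 :|: A2) p.1 p.2) Y (join_v A1 A2 f1 f2 p.1 p.2 Y))).
by rewrite -(@foldr_allpairs _ _ _ (fun X1 X2 f => foldr (fun Y f =>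
  update_opt f (join_X (A1 :|: A2) X1 X2) Y (join_v A1 A2 f1 f2 X1 X2 Y)) f LB)).
Qed.

Lemma join_table_ok (A1 A2 : {set V}) f1 f2 (L1 L2 LB : seq {set V}) : [disjoint A1 & A2] ->
  table_ok A1 f1 -> table_ok A2 f2 ->
  L1 =i traces A1 -> L2 =i traces A2 -> LB =i traces (~: (A1 :|: A2)) ->
  table_ok (A1 :|: A2) (join_table A1 A2 f1 f2 L1 L2 LB).
Proof.
move=> dA [s1 c1] [s2 c2] e1 e2 eB; rewrite join_tableE.
split=> [X Y m|S Y sS tY dS].
  case/updates_sound=> // -[[[X1 X2] {}Y] /= [_ -> ->]].
  rewrite /join_v /addo; case f1m: (f1 _ _) => [m1|] //.
  case f2m: (f2 _ _) => [m2|] // [<-].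
  have [S1 [sS1 cS1 nS1 dS1]] := s1 _ _ _ f1m.
  have [S2 [sS2 cS2 nS2 dS2]] := s2 _ _ _ f2m.
  exists (S1 :|: S2); split; first exact: setUSS.
  - rewrite cardsU cS1 cS2; move/disjoint_setI0: (disjointWl sS1 (disjointWr sS2 dA)) => ->.
    by rewrite cards0 subn0.
  - rewrite /join_X -nS1 -nS2 nbhsU; apply/setP=> x; rewrite !inE.
    by case: (x \in A1); case: (x \in A2).
  rewrite nbhsU -nS1 -nS2 in dS1 dS2 *; rewrite subUset; apply/andP; split.
    apply/subsetP=> x /(subsetP dS1); rewrite !inE.
    by do !case: (x \in _).
  apply/subsetP=> x /(subsetP dS2); rewrite !inE.
  by do !case: (x \in _).
have [S' sS' eY] := tracesP _ _ tY.
have sub1 : S :&: A1 \subset A1 by apply: subsetIr.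
have sub2 : S :&: A2 \subset A2 by apply: subsetIr.
set S1 := S :&: A1 in sub1; set S2 := S :&: A2 in sub2.
have eS : S = S1 :|: S2 by rewrite /S1 /S2 -setIUr; apply/esym/setIidPl.
have n12 x : x \in A1 -> x \notin A2 by move=> xA; rewrite (disjointFr dA).
set X1 := nbhs S1 :\: A1; set X2 := nbhs S2 :\: A2.
have tX1 : X1 \in traces A1 by apply/tracesP; exists S1.
have tX2 : X2 \in traces A2 by apply/tracesP; exists S2.
have nS' x : x \in S' -> x \notin A1 :|: A2 by move=> /(subsetP sS'); rewrite inE.
(* Completeness of [f1] applies to traces only. Here the help is the trace of [S2 :|: S'], a set
   outside of [A1], where [S'] is a set with trace [Y]. *)
have tY1 : (X2 :|: Y) :&: A1 \in traces (~: A1).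
  apply/tracesP; exists (S2 :|: S').
    apply/subsetP=> x; rewrite !inE => /orP[/andP[_]|/nS'].
      by apply: contraL => /n12.
    by rewrite inE negb_or => /andP[].
  rewrite nbhsU eY /X2; apply/setP=> x; rewrite !inE.
  case xA: (x \in A1); last by rewrite andbF.
  by rewrite (negPf (n12 _ xA)) /= andbT.
have tY2 : (X1 :|: Y) :&: A2 \in traces (~: A2).
  apply/tracesP; exists (S1 :|: S').
    apply/subsetP=> x; rewrite !inE => /orP[/andP[_ /n12]//|/nS'].
    by rewrite inE negb_or => /andP[].
  rewrite nbhsU eY /X1; apply/setP=> x; rewrite !inE.
  case xA: (x \in A2); last by rewrite andbF.
  have -> : x \in A1 = false by apply: contraTF xA => /n12.
  by rewrite /= andbT.
have d1 : A1 \subset S1 :|: nbhs S1 :|: ((X2 :|: Y) :&: A1).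
  apply/subsetP=> x xA; have := subsetP dS x; rewrite eS nbhsU !inE xA.
  rewrite (negPf (n12 _ xA)) !andbT !andbF /= orbF => /(_ isT).
  by do !case: (x \in _).
have d2 : A2 \subset S2 :|: nbhs S2 :|: ((X1 :|: Y) :&: A2).
  apply/subsetP=> x xA; have := subsetP dS x; rewrite eS nbhsU !inE xA.
  have -> : x \in A1 = false by apply: contraTF xA => /n12.
  rewrite !orbT !andbT !andbF /= => /(_ isT).
  by do !case: (x \in _).
have [m1 f1m le1] := c1 _ _ sub1 tY1 d1.
have [m2 f2m le2] := c2 _ _ sub2 tY2 d2.
have key : ((X1, X2), Y) \in
    [seq (p, Y) | p <- [seq (X1, X2) | X1 <- L1, X2 <- L2], Y <- LB].
  by rewrite !allpairs_f ?e1 ?e2 ?eB.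
have kv : join_v A1 A2 f1 f2 X1 X2 Y = Some (m1 + m2).
  by rewrite /join_v f1m f2m.
have [m em lem] := updates_complete (fun p => join_X (A1 :|: A2) p.1.1 p.1.2)
  snd (kv := fun p => join_v A1 A2 f1 f2 p.1.1 p.1.2 p.2) no_table key kv.
exists m.
  rewrite -em /=; congr (updates _ _ _ _ _ _ _).
  rewrite /join_X /X1 /X2 eS nbhsU; apply/setP=> x; rewrite !inE.
  by case: (x \in A1); case: (x \in A2).
apply: leq_trans lem _; rewrite eS cardsU.
have -> : S1 :&: S2 = set0.
  by apply/disjoint_setI0; apply: disjointWl sub1 (disjointWr sub2 dA).
by rewrite cards0 subn0 leq_add.
Qed.

(** Nothing lies outside of [setT], so all solutions have the empty trace and the empty help, and a
    single entry holds their minimum. *)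
Lemma table_domination f : table_ok setT f ->
  f set0 set0 = Some (domination_number e).
Proof.
case=> sf cf; rewrite /domination_number.
have domE S : dominating e S = (setT \subset S :|: nbhs S :|: set0).
  apply/forallP/subsetP=> [H x _|H x]; rewrite ?inE.
    rewrite orbF; case/orP: (H x) => [->//|/exists_inP[y yS exy]].
    by apply/orP; right; apply/nbhsP; exists y; rewrite // e_sym.
  have := H x; rewrite !inE orbF => /(_ isT)/orP[->//|/nbhsP[y yS eyx]].
  by apply/orP; right; apply/exists_inP; exists y; rewrite // e_sym.
case: arg_minnP => [|S dS minS].
  by apply/forallP=> x; rewrite inE.
have [||m fm lem] := cf S set0 (subsetT _); rewrite -?domE //.
  by rewrite setCT traces_set0 inE.
rewrite setDT in fm; rewrite fm; congr Some; apply/eqP; rewrite eqn_leq lem.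
have [S' [_ <- _ dS']] := sf _ _ _ fm.
by rewrite minS // domE.
Qed.

End Neighborhoods.

(** * Trees *)

Section RootedTree.
Variables (T : finType) (eT : rel T).

(** A simple path avoiding the edge would close up with it to a cycle. By acyclicity the path has at
    most one step, so either [x = y] or the path is the deleted edge itself. *)
Lemma tree_bridge x y : simple_graph eT -> acyclic eT -> eT x y ->
  ~~ connect (del_edge eT x y) x y.
Proof.
move=> [sT iT] acT exy; apply/negP=> /connectP[p pp lp].
have xy : x != y by apply: contraTneq exy => ->; rewrite iT.
case: (shortenP pp) lp => q pq uq _ lq.
have pq' : path eT x q.
  by apply: sub_path pq => u v /andP[/andP[]].
have /acT : ucycle eT (x :: q).
  by rewrite /ucycle uq /cycle rcons_path pq' -lq sT exy.
move=> sq; case: q pq lq sq {pq' uq} => [_ /= exy'|z [|//]] /=.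
  by rewrite exy' eqxx in xy.
by move=> + ezy; rewrite -ezy /del_edge /= eqxx !andbF.
Qed.

(** [par] fixes the root, so that it is a total function whose orbits are the ancestors; [dep] is
    the measure for inductions. The last clause says that the tree has only parent edges. *)
Definition rooted (r : T) (par : T -> T) (dep : T -> nat) : Prop :=
  [/\ par r = r,
      forall x, x != r -> eT x (par x),
      forall x, x != r -> dep (par x) < dep x &
      forall x y, eT x y -> (x != r) && (y == par x) || (y != r) && (x == par y)].

(** [dep] is the distance to [r], and [par] selects a neighbor that is closer. If an edge [xy] were
    not a parent edge, both ends would still reach the root along parents after its deletion,
    against [tree_bridge]. *)
Lemma tree_rooted r : is_tree eT -> exists par dep, rooted r par dep.
Proof.
move=> [[sT iT] _ cT acT].
pose reach x n := [exists p : n.-tuple T, path eT x p && (last x p == r)].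
have reachP x : exists n, reach x n.
  have /connectP[p pp lp] := cT x r; exists (size p); apply/existsP.
  by exists (in_tuple p); rewrite /= pp -lp eqxx.
pose dep x := ex_minn (reachP x).
have depP x : x != r -> exists2 y, eT x y & dep y < dep x.
  rewrite /dep => xr; case: ex_minnP => n /existsP[[p sp] /= /andP[pp /eqP lp]] _.
  rewrite -(eqP sp) {n sp}.
  case: p pp lp => [_ /= exr|y p /= /andP[exy pp] lp]; first by rewrite exr eqxx in xr.
  exists y => //; rewrite ltnS; case: ex_minnP => m _; apply.
  by apply/existsP; exists (in_tuple p); rewrite /= pp lp eqxx.
pose par x := if x == r then r else odflt r [pick y | eT x y && (dep y < dep x)].
have parP x : x != r -> eT x (par x) /\ dep (par x) < dep x.
  move=> xr; rewrite /par (negPf xr); case: pickP => [y /andP[]//|no].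
  by have [y exy dy] := depP x xr; have := no y; rewrite exy dy.
exists par, dep; split=> [|x /parP[]//|x /parP[]//|x y exy]; first by rewrite /par eqxx.
apply: contraT; rewrite negb_or !negb_and !negbK => /andP[nx ny].
have /negP[] := tree_bridge (conj sT iT) acT exy.
have delS : symmetric (del_edge eT x y).
  move=> u v; rewrite /del_edge /= sT -!andbA; congr (_ && _).
  by rewrite andbC !xpair_eqE ![(u == _) && _]andbC.
have toR u : connect (del_edge eT x y) u r.
  have [n] := ubnP (dep u); elim: n u => // n IHn u lt.
  have [->|ur] := eqVneq u r; first exact: connect0.
  have [eu du] := parP u ur.
  apply: connect_trans (IHn (par u) _); last by lia.
  apply: connect1; rewrite /del_edge /= eu !xpair_eqE /=.
  apply/andP; split; apply/negP=> /andP[/eqP eu1 /eqP eu2].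
    by move: nx; rewrite -eu1 -eu2 eqxx (negPf ur).
  by move: ny; rewrite -eu1 -eu2 eqxx (negPf ur).
have cS : connect_sym (del_edge eT x y) by exact: sym_connect_sym.
by apply: connect_trans (toR x) _; rewrite cS.
Qed.

Section Rooted.
Variables (r : T) (par : T -> T) (dep : T -> nat).
Hypotheses (sT : symmetric eT) (rT : rooted r par dep).

Lemma par_root : par r = r. Proof. by case: rT. Qed.
Lemma par_edge x : x != r -> eT x (par x). Proof. by case: rT => _ H _ _; apply: H. Qed.
Lemma dep_par x : x != r -> dep (par x) < dep x.
Proof. by case: rT => _ _ H _; apply: H. Qed.
Lemma edge_par x y : eT x y -> (x != r) && (y == par x) || (y != r) && (x == par y).
Proof. by case: rT => _ _ _; apply. Qed.

(** The upper node is the first argument: [x] lies on the way from [y] to the root. *)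
Definition desc (x y : T) : bool := fconnect par y x.
Definition children (x : T) : {set T} := [set c | (c != r) && (par c == x)].

Lemma dep_iter n x : dep (iter n par x) <= dep x.
Proof.
elim: n => //= n; apply: leq_trans.
have [->|/dep_par/ltnW//] := eqVneq (iter n par x) r.
by rewrite par_root.
Qed.

Lemma dep_desc x y : desc x y -> dep x <= dep y.
Proof. by move/iter_findex=> <-; apply: dep_iter. Qed.

Lemma desc_root y : desc r y.
Proof.
have [n] := ubnP (dep y); elim: n y => // n IHn y lt.
have [->|yr] := eqVneq y r; first exact: connect0.
have := dep_par yr => d.
by apply: connect_trans (fconnect1 _ _) (IHn (par y) _); lia.
Qed.

Lemma desc_child x y :
  desc x y = (y == x) || [exists c in children x, desc c y].
Proof.
apply/idP/orP=> [xy|[/eqP->|/exists_inP[c]]]; last 2 first.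
- exact: connect0.
- rewrite inE => /andP[_ /eqP <-] cy.
  exact: connect_trans cy (fconnect1 _ _).
have [|yx] := eqVneq y x; [by left|right].
have ex : exists n, iter n par y == x by exists (findex par y x); rewrite iter_findex.
(* The child sought is the node just before [x] on the way up from [y]. It is not the root, since
   [par r = r] would then give a smaller number of steps. *)
case: (ex_minnP ex) => -[|n] /eqP /= en minn; first by rewrite en eqxx in yx.
apply/exists_inP; exists (iter n par y); last exact: fconnect_iter.
rewrite inE en eqxx andbT; apply: contraT; rewrite negbK => /eqP er.
by have := minn n; rewrite -en er par_root eqxx ltnn => /(_ isT).
Qed.

Lemma child_dep c x : c \in children x -> dep x < dep c.
Proof. by rewrite inE => /andP[cr /eqP <-]; apply: dep_par. Qed.

Lemma child_not_anc c x : c \in children x -> ~~ desc c x.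
Proof. by move=> /child_dep; rewrite ltnNge; apply: contra => /dep_desc. Qed.

(** The ancestors of [y] form a chain. If [c2] came strictly after [c1] on it, it would be an
    ancestor of [par c1 = x], although it is deeper than [x]. *)
Lemma siblings_eq c1 c2 x y :
  c1 \in children x -> c2 \in children x -> desc c1 y -> desc c2 y -> c1 = c2.
Proof.
wlog: c1 c2 / findex par y c1 <= findex par y c2.
  move=> H ch1 ch2 d1 d2; case/orP: (leq_total (findex par y c1) (findex par y c2)) => le.
    exact: H.
  by apply/esym/H.
move=> le ch1 ch2 d1 d2; case: (ltngtP (findex par y c1) (findex par y c2)) le => // [lt _|e _].
  have := child_dep ch2; move: ch1; rewrite inE => /andP[_ /eqP epc].
  rewrite -epc -(iter_findex d2) -(subnK lt) addnS -addSn iterD iter_findex //.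
  by rewrite iterSr ltnNge dep_iter.
by rewrite -(iter_findex d1) -(iter_findex d2) e.
Qed.

(** The edge from [x] to its parent is the only one that leaves the subtree of [x], and climbing
    from a descendant up to [x] does not use it. *)
Lemma desc_side x y : x != r -> connect (del_edge eT x (par x)) x y = desc x y.
Proof.
move=> xr; apply/idP/idP.
  case/connectP=> p pp ->; have xx : desc x x by exact: connect0.
  move: xx.
  elim: p {3 5 7}x pp => //= v p IHp u /andP[/andP[/andP[euv n1] n2] pp] xu.
  apply: IHp pp _; case/orP: (edge_par euv) => /andP[_ /eqP ev]; last first.
    by apply: connect_trans xu; rewrite ev; apply: fconnect1.
  move: xu; rewrite /desc fconnect_eqVf.
  case/orP=> [/eqP eux|]; last by rewrite -ev.
  by move: n1; rewrite ev eux eqxx.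
move=> xy; have [n] := ubnP (dep y); elim: n y xy => // n IHn y xy lt.
have [<-|yx] := eqVneq x y; first exact: connect0.
have xpy : desc x (par y).
  by move: xy; rewrite /desc fconnect_eqVf eq_sym (negPf yx).
have yr : y != r.
  apply: contraNneq xr => ey; move: xy; rewrite ey => /iter_findex <-.
  by elim: (findex _ _ _) => //= m /eqP->; rewrite par_root.
have dy := dep_par yr.
apply: connect_trans (IHn _ xpy _) _; first by lia.
apply: connect1; rewrite /del_edge /= sT par_edge //= !xpair_eqE [y == x]eq_sym (negPf yx) andbF andbT.
apply/negP=> /andP[/eqP ep /eqP ey]; have := dep_par xr; rewrite -ey.
by move: dy; rewrite ep; lia.
Qed.

Lemma degreeE x : degree eT x = #|children x| + (x != r).
Proof.
rewrite /degree; have -> : [set y | eT x y] =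
    children x :|: (if x == r then set0 else [set par x]).
  apply/setP=> y; rewrite !inE; apply/idP/orP.
    case/edge_par/orP=> /andP[nr /eqP exy]; last by left; rewrite nr exy eqxx.
    by right; rewrite (negPf nr) inE exy.
  case=> [/andP[yr /eqP <-]|]; first by rewrite sT par_edge.
  by case: eqVneq => [_|xr]; rewrite inE // => /eqP->; apply: par_edge.
rewrite cardsU; case: eqVneq => [_|xr] /=; first by rewrite setI0 cards0 addn0 subn0.
rewrite cards1; suff -> : children x :&: [set par x] = set0 by rewrite cards0 subn0.
apply/setP=> y; rewrite !inE; apply/negP=> /andP[/andP[yr /eqP epy] /eqP ey].
by have := dep_par xr; have := dep_par yr; rewrite epy ey; lia.
Qed.

Lemma sum_children : (\sum_x #|children x|).+1 = #|T|.
Proof.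
have -> : #|T| = #|[set~ r]|.+1.
  by rewrite cardsC1 prednK //; apply/card_gt0P; exists r.
congr _.+1; rewrite -sum1_card [RHS](partition_big par xpredT) //=.
apply: eq_bigr => x _; rewrite -sum1_card; apply: eq_bigl => c.
by rewrite !inE.
Qed.

(** A node is a leaf or has degree at least 3, so degree plus [3 * leaf] is at least 3 everywhere,
    while the degrees add up to at most [2 * #|T|]. This turns bounds in the size of the tree into
    bounds in the number of leaves. *)
Lemma card_tree_le : (forall x, degree eT x != 2) -> #|T| <= 3 * #|[set x | leaf eT x]|.
Proof.
move=> no2; have sumdeg : \sum_x degree eT x <= 2 * #|T|.
  under eq_bigr do rewrite degreeE.
  rewrite big_split /=.
  rewrite mul2n -addnn leq_add //; first by rewrite -sum_children leqnSn.
  by rewrite -sum1_card; apply: leq_sum => x _; apply: leq_b1.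
have : #|T| * 3 <= \sum_x (degree eT x + 3 * leaf eT x).
  rewrite -sum_nat_const; apply: leq_sum => x _; have := no2 x; rewrite /leaf; case: leqP => /=; lia.
rewrite big_split /= -big_distrr /=.
have -> : \sum_x (leaf eT x : nat) = #|[set x | leaf eT x]|.
  by rewrite -sum1dep_card [RHS]big_mkcond; apply: eq_bigr => x _; case: leaf.
have arith n s l : s <= 2 * n -> n * 3 <= s + 3 * l -> n <= 3 * l by lia.
exact: arith sumdeg.
Qed.

(** * The vertex sets gathered in the tree nodes during the merging *)

Section Partial.
Variables (V : finType) (e : rel V) (l : V -> T) (k : nat).
Hypotheses (e_sym : symmetric e) (leaf_l : forall v, leaf eT (l v)).
Hypothesis deg3 : forall x, degree eT x <= 3.

Definition own (x : T) : {set V} := [set v | l v == x].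
Definition below (x : T) : {set V} := [set v | desc x (l v)].

Hypothesis narrow_below : forall x, x != r -> narrow e k (below x).

(* The part of [V] that has been gathered in [x] when the nodes outside of [W]
   have been merged into their parents. *)
Definition partial (W : {set T}) (x : T) : {set V} :=
  own x :|: \bigcup_(c in children x :\: W) below c.

Lemma partialP (W : {set T}) x v :
  reflect (l v = x \/ exists c, [/\ c \in children x, c \notin W & desc c (l v)])
          (v \in partial W x).
Proof.
rewrite inE inE; apply: (iffP orP) => -[/eqP|]; try by left.
- by case/bigcupP=> c; rewrite inE => /andP[cW cx]; rewrite inE; right; exists c.
- case=> c [cx cW cv]; right; apply/bigcupP; exists c; first by rewrite inE cW.
  by rewrite inE.
Qed.

Lemma partial_below (W : {set T}) x :
  [disjoint children x & W] -> partial W x = below x.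
Proof.
move=> dW; apply/setP=> v; rewrite [in RHS]inE desc_child.
apply/partialP/orP=> [[/eqP|[c [cx _ cv]]]|[/eqP|/exists_inP[c cx cv]]]; try by left.
  by right; apply/exists_inP; exists c.
by right; exists c; split=> //; rewrite (disjointFr dW).
Qed.

Lemma below_root : below r = setT.
Proof. by apply/setP=> v; rewrite !inE desc_root. Qed.

Lemma partial_setT x : partial setT x = own x.
Proof. by rewrite /partial setDT big_set0 setU0. Qed.

Lemma narrow_below_all x : narrow e k (below x).
Proof.
have [->|] := eqVneq x r; last exact: narrow_below.
by rewrite below_root -setC0 narrowC narrow0.
Qed.

Lemma own_leaf x : own x != set0 -> leaf eT x.
Proof. by case/set0Pn=> v; rewrite inE => /eqP <-. Qed.

Lemma own_below x c : c \in children x -> [disjoint own x & below c].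
Proof.
move=> cx; rewrite -setI_eq0; apply/eqP/setP=> v; rewrite !inE.
by case: eqVneq => //= ->; apply/negbTE/child_not_anc.
Qed.

(* A union of at most three disjoint parts of [V], of which every part is
   narrow, is empty, a part, the complement of a part, or [V]. *)
Lemma narrow_partial (W : {set T}) x : narrow e k (partial W x).
Proof.
have [|[c0]] := set_0Vmem (children x :&: W).
  by move=> e0; rewrite partial_below ?narrow_below_all // -setI_eq0 e0.
rewrite inE => /andP[c0x c0W].
have sumc : #|children x :\: W| + #|children x :&: W| = #|children x|.
  by have := cardsID W (children x); lia.
have pos : 0 < #|children x :&: W| by apply/card_gt0P; exists c0; rewrite inE c0x.
have dg := degreeE x; have d3 := deg3 x.
have [own0|ownN] := eqVneq (own x) set0; last first.
  (* A node that owns a vertex has degree at most 1. As it has the child [c0], it is the root and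
     [c0] is its only neighbor, so [own x] is the complement of [below c0]. *)
  have lx := own_leaf ownN; rewrite /leaf dg in lx.
  have xr : x = r by apply/eqP; apply: contraTT lx => ->; lia.
  have cI : children x :\: W = set0 by apply/eqP; rewrite -cards_eq0; lia.
  rewrite /partial cI big_set0 setU0.
  have -> : own x = ~: below c0.
    apply/setP=> v; have := desc_root (l v); rewrite -xr desc_child !inE.
    have -> : [exists c in children x, desc c (l v)] = desc c0 (l v).
      apply/exists_inP/idP=> [[c cx]|]; last by exists c0.
      have /card_le1_eqP H : #|children x| <= 1 by lia.
      by have <- : c = c0 := H _ _ c0x cx.
    case: eqVneq => [->|_ /= ->] // _.
    by rewrite (negPf (child_not_anc c0x)).
  by rewrite narrowC narrow_below_all.
rewrite /partial own0 set0U.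
have [le1|gt1] := leqP #|children x :\: W| 1.
  have [->|[c cI]] := set_0Vmem (children x :\: W); first by rewrite big_set0 narrow0.
  have -> : children x :\: W = [set c].
    by apply/eqP; rewrite eq_sym eqEcard sub1set cI cards1.
  by rewrite big_set1 narrow_below_all.
(* Two children outside of [W] and the child [c0] in [W] exhaust the degree and leave no edge to a
   parent. At the root, everything but the subtree of [c0] has been gathered. *)
have xr : x = r by apply/eqP; apply: contraTT d3 => xr; rewrite dg xr; lia.
have -> : \bigcup_(c in children x :\: W) below c = ~: below c0.
  apply/setP=> v; rewrite !inE; apply/bigcupP/idP=> [[c]|nc0].
    rewrite !inE => /andP[cW cx] cv; apply: contra cW => c0v.
    by rewrite (@siblings_eq c c0 x (l v)) // inE.
  have := desc_root (l v); rewrite -xr desc_child => /orP[/eqP lv|/exists_inP[c cx cv]].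
    by have := in_set0 v; rewrite -own0 inE lv eqxx.
  exists c; last by rewrite inE.
  rewrite inE cx andbT; apply/negP=> cW; move: nc0.
  have /card_le1_eqP H : #|children x :&: W| <= 1 by lia.
  have cI : c \in children x :&: W by rewrite inE cx.
  have c0I : c0 \in children x :&: W by rewrite inE c0x.
  by have <- : c = c0 := H _ _ c0I cI; rewrite cv.
by rewrite narrowC narrow_below_all.
Qed.

(** When none of its children is active, [x] has gathered its whole subtree, which is just what its
    parent lacks as long as [x] is in [W]. *)
Lemma partial_merge (W : {set T}) x : x \in W -> x != r -> [disjoint children x & W] ->
  partial (W :\ x) (par x) = partial W (par x) :|: partial W x /\
  [disjoint partial W (par x) & partial W x].
Proof.
move=> xW xr cx.
have xp : x \in children (par x) by rewrite inE xr eqxx.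
rewrite (partial_below cx); split.
  apply/setP=> v; rewrite [in RHS]in_setU; apply/partialP/orP.
    case=> [ev|[c [cp]]]; first by left; apply/partialP; left.
    rewrite in_setD1 negb_and negbK => /orP[/eqP->|cW] cv; first by right; rewrite inE.
    by left; apply/partialP; right; exists c.
  case=> [/partialP[->|[c [cp cW cv]]]|]; first by left.
    by right; exists c; split=> //; rewrite !inE (negPf cW) andbF.
  by rewrite inE => xv; right; exists x; split=> //; rewrite !inE eqxx.
rewrite -setI_eq0; apply/eqP/setP=> v; rewrite in_setI [in RHS]inE; apply/negP=> /andP[].
case/partialP=> [ev|[c [cp cW cv]]]; rewrite inE => xv.
  by have := own_below xp => /disjoint_setI0/setP/(_ v); rewrite !inE ev eqxx -ev xv.
by move: cW; rewrite (siblings_eq cp xp cv xv) xW.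
Qed.

Lemma partial_other (W : {set T}) x y : y != par x -> partial (W :\ x) y = partial W y.
Proof.
move=> yx; apply/setP=> v; apply/partialP/partialP=> -[ev|[c [cy cW cv]]]; try by left.
  right; exists c; split=> //; apply: contra cW; rewrite !inE => ->; rewrite andbT.
  by apply: contraNneq yx => <-; move: cy; rewrite inE => /andP[_ /eqP->].
by right; exists c; split=> //; rewrite !inE (negPf cW) andbF.
Qed.

End Partial.

(** The active nodes form a subtree containing the root, which stays at the head of the list. The
    program has no parent pointers: it looks in the tail of the list for a node with a single active
    neighbor, and the next two lemmas relate such nodes to parents. *)
Definition active (W : seq T) : Prop :=
  [/\ uniq W, exists W', W = r :: W' &
      forall x, x \in W -> x != r -> par x \in W].

(** A deepest active node other than the root has no active child, so its parent is its only active
    neighbor. *)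
Lemma active_merge_ex W : active W -> 1 < size W ->
  exists2 x, x \in behead W & size [seq y <- W | eT x y] = 1.
Proof.
case=> uW [W' eW] clW sW; have -> : behead W = W' by rewrite eW.
have [x0 x0W] : exists x, x \in W'.
  by move: sW; rewrite eW; case: W' {eW} => // x W' _; exists x; rewrite inE eqxx.
case: (@arg_maxnP _ x0 (mem W') dep x0W) => x xW maxx.
exists x => //.
have xr : x != r by apply: contraTneq uW => exr; rewrite eW /= -exr (xW : x \in W').
have xW0 : x \in W by rewrite eW inE (xW : x \in W') orbT.
have -> : [seq y <- W | eT x y] = [seq y <- W | y == par x].
  apply: eq_in_filter => y yW; apply/idP/eqP=> [|->]; last exact: par_edge.
  case/edge_par/orP=> /andP[yr /eqP exy] //.
  have yW' : y \in W' by move: yW; rewrite eW inE (negPf yr).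
  by have := dep_par yr; have := maxx y yW'; rewrite exy; lia.
by rewrite size_filter count_uniq_mem // clW.
Qed.

(** The parent of [x] is active by closure, so the only active neighbor is the parent and no child
    of [x] is active. *)
Lemma active_merge W x p : active W -> x \in behead W ->
  [seq y <- W | eT x y] = [:: p] ->
  [/\ x \in W, x != r, p = par x, [disjoint children x & [set y in W]] &
      active [seq y <- W | y != x]].
Proof.
case=> uW [W' eW] clW xW' ep.
have xW : x \in W by rewrite eW inE; rewrite eW in xW'; rewrite xW' orbT.
have xr : x != r.
  by apply: contraTneq uW => exr; rewrite eW /= -exr; rewrite eW /= in xW'; rewrite xW'.
have inp y : y \in W -> eT x y -> y = p.
  by move=> yW exy; apply/eqP; rewrite -mem_seq1 -ep mem_filter exy.
have epx : p = par x by apply/esym/inp; [apply: clW|apply: par_edge].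
have nch y : y \in children x -> y \notin W.
  move=> yx; apply/negP=> yW; have dy := child_dep yx; have dx := dep_par xr.
  move: yx; rewrite inE => /andP[yr /eqP exy].
  have /inp : eT x y by rewrite sT -exy par_edge.
  by move=> /(_ yW) eyp; move: dy dx; rewrite eyp epx; lia.
split=> //.
  by rewrite disjoint_subset; apply/subsetP=> y /nch; rewrite !inE.
split; first exact: filter_uniq.
  by rewrite eW /= eq_sym xr; eexists.
move=> y; rewrite !mem_filter => /andP[yx yW] yr; rewrite clW // andbT.
apply: contraTneq yW => epy; apply: nch; by rewrite inE yr epy eqxx.
Qed.

End Rooted.
End RootedTree.

(** * List programs *)

(* A term is evaluated at a datum, which is usually read as the list of the
   values of the variables. As in [ECase], the first branch of [HIf] is the one
   for [Nil]. [HFold w i l f] folds [f] from the right over [l]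
   with initial value [i]; the element and the accumulated value are pushed in
   front of the datum. The annotation [w] only serves the analysis: the length
   of [l] has to be at most [L * M ^ w]. *)
Inductive hl : Type :=
| HEnv
| HNil
| HCons of hl & hl
| HHd of hl
| HTl of hl
| HIf of hl & hl & hl
| HComp of hl & hl
| HFold of nat & hl & hl & hl.

Definition dhd (d : data) : data := if d is Cons a _ then a else Nil.
Definition dtl (d : data) : data := if d is Cons _ b then b else Nil.
Fixpoint lst (d : data) : seq data := if d is Cons a b then a :: lst b else [::].

Fixpoint den (m : hl) (d : data) : data :=
  match m with
  | HEnv => d
  | HNil => Nil
  | HCons a b => Cons (den a d) (den b d)
  | HHd a => dhd (den a d)
  | HTl a => dtl (den a d)
  | HIf a b c => if den a d is Nil then den b d else den c d
  | HComp f a => den f (den a d)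
  | HFold _ i l f =>
      foldr (fun x acc => den f (Cons x (Cons acc d))) (den i d) (lst (den l d))
  end.

(* The function for a fold over [l], called with [Cons l (Cons i d)]. *)
Definition fold_fun (n : nat) (f : expr) : expr :=
  ECase (EVar 0) ENil
    (ECase (EVar 0) (ECase (EVar 1) ENil (EVar 0))
      (ELet (ECall n (ECons (EVar 1) (EVar 3)))
        (ECase (EVar 4) ENil
          (ELet (ECons (EVar 3) (ECons (EVar 2) (EVar 1))) f)))).

(** Returns an expression together with its auxiliary functions, one for each fold, numbered from
    [n]. Compiled terms expect the datum at index 0; a nonempty case has pushed it to index 2,
    whence the [ELet]. *)
Fixpoint comp (n : nat) (m : hl) : expr * seq expr :=
  match m with
  | HEnv => (EVar 0, [::])
  | HNil => (ENil, [::])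
  | HCons a b =>
      let ca := comp n a in let cb := comp (n + size ca.2) b in
      (ECons ca.1 cb.1, ca.2 ++ cb.2)
  | HHd a => let ca := comp n a in (ECase ca.1 ENil (EVar 0), ca.2)
  | HTl a => let ca := comp n a in (ECase ca.1 ENil (EVar 1), ca.2)
  | HIf a b c =>
      let ca := comp n a in let cb := comp (n + size ca.2) b in
      let cc := comp (n + size (ca.2 ++ cb.2)) c in
      (ECase ca.1 cb.1 (ELet (EVar 2) cc.1), (ca.2 ++ cb.2) ++ cc.2)
  | HComp f a =>
      let ca := comp n a in let cf := comp (n + size ca.2) f in
      (ELet ca.1 cf.1, ca.2 ++ cf.2)
  | HFold _ i l f =>
      let cl := comp n l in let ci := comp (n + size cl.2) i in
      let cf := comp (n + size (cl.2 ++ ci.2)) f in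
      let fs := (cl.2 ++ ci.2) ++ cf.2 in
      (ECall (n + size fs) (ECons cl.1 (ECons ci.1 (EVar 0))),
       fs ++ [:: fold_fun (n + size fs) cf.1])
  end.

(** * Running time of compiled list programs *)

Section Cost.
Variables L M : nat.

(* All folds met in the evaluation obey the length bound they are annotated with. *)
Fixpoint ok (m : hl) (d : data) : Prop :=
  match m with
  | HEnv | HNil => True
  | HCons a b => ok a d /\ ok b d
  | HHd a | HTl a => ok a d
  | HIf a b c => ok a d /\ (if den a d is Nil then ok b d else ok c d)
  | HComp f a => ok a d /\ ok f (den a d)
  | HFold w i l f =>
      [/\ ok i d, ok l d, size (lst (den l d)) <= L * M ^ w &
          forall s1 x s2, lst (den l d) = s1 ++ x :: s2 ->
            ok f (Cons x (Cons (foldr (fun x acc => den f (Cons x (Cons acc d)))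
                                      (den i d) s2) d))]
  end.

Fixpoint cost (m : hl) : nat :=
  match m with
  | HEnv | HNil => 1
  | HCons a b | HComp a b => cost a + cost b + 1
  | HHd a | HTl a => cost a + 2
  | HIf a b c => cost a + cost b + cost c + 3
  | HFold w i l f => cost i + cost l + L * M ^ w * (cost f + 17) + 11
  end.

Definition installed (P : program) (n : nat) (fs : seq expr) : Prop :=
  forall j, j < size fs -> nth ENil P (n + j) = nth ENil fs j.

Lemma installed_cat P n fs gs :
  installed P n (fs ++ gs) -> installed P n fs /\ installed P (n + size fs) gs.
Proof.
move=> H; split=> j lj.
  have -> := H j; last by rewrite size_cat; lia.
  by rewrite nth_cat lj.
rewrite -addnA H; last by rewrite size_cat; lia.
by rewrite nth_cat ltnNge leq_addr addKn.
Qed.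

Lemma comp_fold P n d f (F : expr) i l c :
  nth ENil P n = fold_fun n F ->
  (forall s1 x s2, lst l = s1 ++ x :: s2 -> forall r, exists2 t, t <= c &
     let a := foldr (fun x acc => den f (Cons x (Cons acc d))) i s2 in
     eval P (Cons x (Cons a d) :: r) F (den f (Cons x (Cons a d))) t) ->
  exists2 t, t <= size (lst l) * (c + 17) + 7 &
    eval P [:: Cons l (Cons i d)] (nth ENil P n)
      (foldr (fun x acc => den f (Cons x (Cons acc d))) i (lst l)) t.
Proof.
move=> Pn; rewrite Pn; elim: l => [|x _ l IHl] Hf /=.
  exists 7 => //.
  apply: (@eval_case_cons _ _ _ _ _ Nil (Cons i d) _ 1 5); first exact: eval_var.
  apply: (@eval_case_nil _ _ _ _ _ _ 1 3); first exact: eval_var.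
  apply: (@eval_case_cons _ _ _ _ _ i d _ 1 1); first exact: eval_var.
  exact: eval_var.
have [t1 lt1 E1] : exists2 t, t <= size (lst l) * (c + 17) + 7 &
    eval P [:: Cons l (Cons i d)] (fold_fun n F)
      (foldr (fun x acc => den f (Cons x (Cons acc d))) i (lst l)) t.
  by apply: IHl => s1 y s2 els; apply: (Hf (x :: s1)); rewrite /= els.
set a := foldr _ _ _ in E1 *.
(* The tail lists what the bindings of [fold_fun] leave below the datum that is passed to the
   body. *)
have [t2 lt2 E2] := Hf [::] x (lst l) erefl
  [:: i; d; a; x; l; Cons x l; Cons i d; Cons (Cons x l) (Cons i d)].
rewrite -/a in E2.
exists (t1 + t2 + 17); first by lia.
have -> : t1 + t2 + 17 = (1 + (1 + (((1 + 1).+1 + t1).+1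
  + (1 + ((1 + (1 + 1).+1).+1 + t2).+1).+1).+1).+1).+1 by lia.
apply: eval_case_cons; first exact: eval_var.
apply: eval_case_cons; first exact: eval_var.
apply: (@eval_let _ _ _ _ a).
  apply: (@eval_call _ _ _ _ (Cons l (Cons i d))); last by rewrite Pn.
  by apply: eval_cons; apply: eval_var.
apply: (@eval_case_cons _ _ _ _ _ i d); first exact: eval_var.
apply: (@eval_let _ _ _ _ (Cons x (Cons a d))); last exact: E2.
by apply: eval_cons; [|apply: eval_cons]; apply: eval_var.
Qed.

(** The tail [r] is arbitrary because subterms also run below the variables bound by surrounding
    cases and lets. *)
Lemma comp_eval P m : forall n d, installed P n (comp n m).2 -> ok m d ->
  forall r, exists2 t, t <= cost m & eval P (d :: r) (comp n m).1 (den m d) t.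
Proof.
elim: m => [||a IHa b IHb|a IHa|a IHa|a IHa b IHb c IHc|f IHf a IHa|w i IHi l IHl f IHf]
  n d /=.
- by move=> _ _ r; exists 1 => //; apply: eval_var.
- by move=> _ _ r; exists 1 => //; apply: eval_nil.
- case/installed_cat=> Pa Pb [oa ob] r.
  have [s ls Es] := IHa _ _ Pa oa r; have [t lt Et] := IHb _ _ Pb ob r.
  by exists (s + t).+1; [lia|apply: eval_cons].
- move=> Pa oa r; have [s ls] := IHa _ _ Pa oa r.
  case: (den a d) => [|u v] Es; exists (s + 1).+1; try lia.
    by apply: eval_case_nil Es _; apply: eval_nil.
  by apply: eval_case_cons Es _; apply: eval_var.
- move=> Pa oa r; have [s ls] := IHa _ _ Pa oa r.
  case: (den a d) => [|u v] Es; exists (s + 1).+1; try lia.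
    by apply: eval_case_nil Es _; apply: eval_nil.
  by apply: eval_case_cons Es _; apply: eval_var.
- case/installed_cat=> /installed_cat[Pa Pb] Pc [oa obc] r.
  have [s ls] := IHa _ _ Pa oa r.
  case: (den a d) obc => [|u v] obc Es.
    have [t lt Et] := IHb _ _ Pb obc r.
    by exists (s + t).+1; [lia|apply: eval_case_nil Es Et].
  have [t lt Et] := IHc _ _ Pc obc [:: u, v, d & r].
  exists (s + (1 + t).+1).+1; first by lia.
  by apply: eval_case_cons Es _; apply: eval_let Et; apply: eval_var.
- case/installed_cat=> Pa Pf [oa of_] r.
  have [s ls Es] := IHa _ _ Pa oa r; have [t lt Et] := IHf _ _ Pf of_ (d :: r).
  by exists (s + t).+1; [lia|apply: eval_let Es Et].
case/installed_cat=> /installed_cat[/installed_cat[Pl Pi] Pf] Pn [oi ol sl of_] r.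
have [s ls Es] := IHl _ _ Pl ol r; have [t lt Et] := IHi _ _ Pi oi r.
have {}Pn := Pn 0 isT; rewrite addn0 /= in Pn.
have Hf s1 x s2 (els : lst (den l d) = s1 ++ x :: s2) :=
  IHf _ _ Pf (of_ _ _ _ els).
have [u lu Eu] := comp_fold Pn Hf.
exists ((s + (t + 1).+1).+1 + u).+1.
  have := leq_mul2r (cost f + 17) (size (lst (den l d))) (L * M ^ w).
  by rewrite sl orbT; lia.
apply: eval_call Eu.
by apply: eval_cons Es _; apply: eval_cons Et _; apply: eval_var.
Qed.

End Cost.

Fixpoint coef (m : hl) : nat :=
  match m with
  | HEnv | HNil => 1
  | HCons a b | HComp a b => coef a + coef b + 1
  | HHd a | HTl a => coef a + 2
  | HIf a b c => coef a + coef b + coef c + 3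
  | HFold w i l f => coef i + coef l + (coef f + 17) + 11
  end.

Fixpoint depth (m : hl) : nat :=
  match m with
  | HEnv | HNil => 0
  | HCons a b | HComp a b => maxn (depth a) (depth b)
  | HHd a | HTl a => depth a
  | HIf a b c => maxn (maxn (depth a) (depth b)) (depth c)
  | HFold w i l f => maxn (maxn (depth i) (depth l)) (depth f).+1
  end.

Fixpoint weight (m : hl) : nat :=
  match m with
  | HEnv | HNil => 0
  | HCons a b | HComp a b => maxn (weight a) (weight b)
  | HHd a | HTl a => weight a
  | HIf a b c => maxn (maxn (weight a) (weight b)) (weight c)
  | HFold w i l f => maxn (maxn (weight i) (weight l)) (w + weight f)
  end.

(** Sequential parts contribute the maximum of the exponents; a fold adds one to the exponent of [L]
    and its annotation to that of [M]. Thus the power of [2 ^ k] in the running time is read off the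
    syntax. *)
Lemma cost_le m L M : 0 < L -> 0 < M ->
  cost L M m <= coef m * (L ^ depth m * M ^ weight m).
Proof.
move=> L0 M0.
have mono D W D' W' x c : D <= D' -> W <= W' -> x <= c * (L ^ D * M ^ W) ->
    x <= c * (L ^ D' * M ^ W').
  move=> dD dW /leq_trans; apply; rewrite leq_mul2l leq_mul ?orbT //;
  by apply: leq_pexp2l.
have pos D W : 0 < L ^ D * M ^ W by rewrite muln_gt0 !expn_gt0 L0 M0.
elim: m => [||a IHa b IHb|a IHa|a IHa|a IHa b IHb c IHc|f IHf a IHa|w i IHi l IHl f IHf] //=.
- have := mono _ _ _ _ _ _ (leq_maxl _ (depth b)) (leq_maxl _ (weight b)) IHa.
  have := mono _ _ _ _ _ _ (leq_maxr (depth a) _) (leq_maxr (weight a) _) IHb.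
  by have := pos (maxn (depth a) (depth b)) (maxn (weight a) (weight b)); lia.
- by have := pos (depth a) (weight a); lia.
- by have := pos (depth a) (weight a); lia.
- set D := maxn _ (depth c); set W := maxn _ (weight c).
  have := mono _ _ D W _ _ _ _ IHa; have := mono _ _ D W _ _ _ _ IHb.
  have := mono _ _ D W _ _ _ _ IHc; have := pos D W.
  rewrite /D /W !leq_max !leqnn !orbT /= => p Hc Hb Ha.
  by have := Hc isT isT; have := Hb isT isT; have := Ha isT isT; lia.
- have := mono _ _ _ _ _ _ (leq_maxl _ (depth a)) (leq_maxl _ (weight a)) IHf.
  have := mono _ _ _ _ _ _ (leq_maxr (depth f) _) (leq_maxr (weight f) _) IHa.
  by have := pos (maxn (depth f) (depth a)) (maxn (weight f) (weight a)); lia.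
set D := maxn _ (depth f).+1; set W := maxn _ (w + weight f).
have := mono _ _ D W _ _ _ _ IHi; have := mono _ _ D W _ _ _ _ IHl.
have : L * M ^ w * (cost L M f + 17) <= (coef f + 17) * (L ^ D * M ^ W).
  apply: (mono (depth f).+1 (w + weight f)); rewrite ?leq_max ?leqnn ?orbT //.
  rewrite expnS expnD mulnC.
  have -> : (coef f + 17) * (L * L ^ depth f * (M ^ w * M ^ weight f)) =
    (coef f + 17) * (L ^ depth f * M ^ weight f) * (L * M ^ w) by lia.
  rewrite leq_mul2r; apply/orP; right.
  by have := pos (depth f) (weight f); lia.
have := pos D W; rewrite /D /W !leq_max !leqnn !orbT /= => p Hf Hl Hi.
by have := Hl isT isT; have := Hi isT isT; lia.
Qed.

(** * Rules for establishing value and loop bounds together *)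

Section Spec.
Variables L M : nat.

Definition yields (m : hl) (d v : data) : Prop := ok L M m d /\ den m d = v.

Lemma yields_env d : yields HEnv d d. Proof. by []. Qed.
Lemma yields_nil d : yields HNil d Nil. Proof. by []. Qed.
Lemma yields_cons a b d u v : yields a d u -> yields b d v -> yields (HCons a b) d (Cons u v).
Proof. by case=> ? <- [? <-]. Qed.
Lemma yields_hd a d u v : yields a d (Cons u v) -> yields (HHd a) d u.
Proof. by case=> ? /= H; split=> //=; rewrite H. Qed.
Lemma yields_tl a d u v : yields a d (Cons u v) -> yields (HTl a) d v.
Proof. by case=> ? /= H; split=> //=; rewrite H. Qed.
Lemma yields_dhd a d u : yields a d u -> yields (HHd a) d (dhd u).
Proof. by case=> ? /= H; split=> //=; rewrite H. Qed.
Lemma yields_dtl a d u : yields a d u -> yields (HTl a) d (dtl u).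
Proof. by case=> ? /= H; split=> //=; rewrite H. Qed.
Lemma yields_comp f a d u v : yields a d u -> yields f u v -> yields (HComp f a) d v.
Proof. by case=> oa ea [of_ ef]; split; rewrite /= ea. Qed.
Lemma yields_if_nil a b c d v : yields a d Nil -> yields b d v -> yields (HIf a b c) d v.
Proof. by case=> oa ea [ob eb]; rewrite /yields /= ea. Qed.
Lemma yields_if_cons a b c d u1 u2 v :
  yields a d (Cons u1 u2) -> yields c d v -> yields (HIf a b c) d v.
Proof. by case=> oa ea [ob eb]; rewrite /yields /= ea. Qed.

Lemma lst_enc s : lst (enc_seq s) = s.
Proof. by elim: s => //= x s ->. Qed.

(** The loop rule with an invariant [R] between the suffix already processed and the accumulator.
    The relational form is for tables, which are specified only up to the trie representing them. *)
Lemma yields_fold_ex (X : Type) (g : X -> data) (s : seq X) (R : seq X -> data -> Prop)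
    w i l f d a :
  yields l d (enc_seq [seq g x | x <- s]) -> yields i d a -> size s <= L * M ^ w ->
  R [::] a ->
  (forall s1 x s2 acc, s = s1 ++ x :: s2 -> R s2 acc ->
     exists2 v, yields f (Cons (g x) (Cons acc d)) v & R (x :: s2) v) ->
  exists2 v, yields (HFold w i l f) d v & R s v.
Proof.
move=> [ol el] [oi ei] sz R0 Rs; rewrite /yields /= el lst_enc ei size_map.
pose F := foldr (fun x acc => den f (Cons x (Cons acc d))) a.
have RF s1 s2 : s = s1 ++ s2 -> R s2 (F (map g s2)).
  elim: s2 s1 => //= x s2 IH s1 es.
  have {}IH : R s2 (F (map g s2)) by apply: (IH (rcons s1 x)); rewrite cat_rcons.
  by have [v [_ <-]] := Rs _ _ _ _ es IH.
exists (F (map g s)); last exact: (RF [::]).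
split=> //; split=> // s1 x s2 es.
have [t1 [[|y t2] [es' [E1 E2]]]] : exists t1 t2, s = t1 ++ t2 /\
    (map g t1 = s1 /\ map g t2 = x :: s2).
- exists (take (size s1) s), (drop (size s1) s); rewrite cat_take_drop; split=> //.
  by rewrite map_take map_drop es take_size_cat // drop_size_cat.
- by [].
have [|v []] := Rs _ _ _ (F (map g t2)) es'.
  by apply: (RF (rcons t1 y)); rewrite cat_rcons.
by case: E2 => -> <-.
Qed.

Lemma yields_fold (X : Type) (g : X -> data) (s : seq X) (F : seq X -> data) w i l f d :
  yields l d (enc_seq [seq g x | x <- s]) -> yields i d (F [::]) -> size s <= L * M ^ w ->
  (forall s1 x s2, s = s1 ++ x :: s2 ->
     yields f (Cons (g x) (Cons (F s2) d)) (F (x :: s2))) ->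
  yields (HFold w i l f) d (F s).
Proof.
move=> el ei sz H.
have [] := @yields_fold_ex _ g s (fun s v => v = F s) w i l f d _ el ei sz erefl.
  by move=> s1 x s2 _ es ->; exists (F (x :: s2)) => //; apply: H es.
by move=> v Ev <-.
Qed.

End Spec.

Notation "[ 'env' a ; .. ; b ]" := (Cons a .. (Cons b Nil) ..)
  (at level 0, format "[ 'env'  a ;  .. ;  b ]").

(** * The programs: lists, unary numbers, tries, sets, and tables *)

Definition var (i : nat) : hl := HHd (iter i HTl HEnv).
Definition call (f : hl) (s : seq hl) : hl := HComp f (foldr HCons HNil s).
Definition hlet (a b : hl) : hl := HComp b (HCons a HEnv).
Definition htrue : hl := HCons HNil HNil.

Definition rcons_ : hl :=
  HFold 0 (HCons (var 1) HNil) (var 0) (HCons (var 0) (var 1)).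
Definition rev_ : hl :=
  HFold 0 HNil (var 0) (call rcons_ [:: var 1; var 0]).
Definition cat_ : hl := HFold 0 (var 1) (var 0) (HCons (var 0) (var 1)).
(** The fold meets the first list from its end, so the second one is reversed and consumed from its
    head. *)
Definition zip_ : hl :=
  HHd (HFold 0 (HCons HNil (call rev_ [:: var 1])) (var 0)
    (HCons (HCons (HCons (var 0) (HHd (HTl (var 1)))) (HHd (var 1)))
           (HTl (HTl (var 1))))).
Definition sub_ : hl := HFold 0 (var 0) (var 1) (HTl (var 1)).
Definition eqn_ : hl :=
  HIf (call sub_ [:: var 0; var 1])
    (HIf (call sub_ [:: var 1; var 0]) htrue HNil) HNil.
Definition zeros_ : hl := HFold 0 HNil (var 0) (HCons HNil (var 1)).
(** The last position is met first, so the unary counter starts one below the length and goes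
    down. *)
Definition indices_ : hl :=
  HHd (HFold 0 (HCons HNil (HTl (call zeros_ [:: var 0]))) (var 0)
    (HCons (HCons (HTl (var 1)) (HHd (var 1))) (HTl (HTl (var 1))))).
Definition unit_ : hl :=
  HFold 0 HNil (call indices_ [:: var 0])
    (HCons (call eqn_ [:: var 0; var 3]) (var 1)).

Definition get_ : hl :=
  HFold 0 (var 0) (var 1) (HIf (var 0) (HHd (var 1)) (HTl (var 1))).
(** Tries are descended from the last bit of the key, the one that a right fold meets first. Cells
    being immutable, [path_] records the subtrees passed, the deepest in front, and [put_] rebuilds
    them from the bottom up. *)
Definition path_ : hl :=
  HTl (HFold 0 (HCons (var 0) HNil) (var 1)
    (HCons (HIf (var 0) (HHd (HHd (var 1))) (HTl (HHd (var 1))))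
           (HCons (HCons (var 0) (HHd (var 1))) (HTl (var 1))))).
Definition put_ : hl :=
  HFold 0 (var 2) (call rev_ [:: call path_ [:: var 0; var 1]])
    (HIf (HHd (var 0)) (HCons (var 1) (HTl (HTl (var 0))))
                       (HCons (HHd (HTl (var 0))) (var 1))).
Definition putmin_ : hl :=
  hlet (call get_ [:: var 0; var 1])
    (HIf (var 0) (call put_ [:: var 1; var 2; HCons HNil (var 3)])
      (HIf (call sub_ [:: var 3; HTl (var 0)])
        (call put_ [:: var 1; var 2; HCons HNil (var 3)]) (var 1))).

Definition bitwise_ (f : hl) : hl :=
  HFold 0 HNil (call zip_ [:: var 0; var 1]) (HCons f (var 1)).
Definition fst_ : hl := HHd (var 0).
Definition snd_ : hl := HTl (var 0).
Definition union_ : hl := bitwise_ (HIf fst_ snd_ fst_).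
Definition inter_ : hl := bitwise_ (HIf fst_ HNil snd_).
Definition diff_ : hl := bitwise_ (HIf snd_ fst_ HNil).
Definition compl_ : hl := HFold 0 HNil (var 0) (HCons (HIf (var 0) htrue HNil) (var 1)).
Definition subset_ : hl :=
  HFold 0 htrue (call zip_ [:: var 0; var 1])
    (HIf fst_ (var 1) (HIf snd_ HNil (var 1))).
Definition eqset_ : hl :=
  HIf (call subset_ [:: var 0; var 1]) HNil (call subset_ [:: var 1; var 0]).
Definition mem_ : hl :=
  HFold 1 HNil (var 1) (HIf (call eqset_ [:: var 0; var 2]) (var 1) htrue).

(** Duplicates are found by linear search, which costs a second factor [M]; this stays below the
    three factors of [join_]. *)
Definition extend_ : hl :=
  HFold 1 (var 1) (var 1)
    (hlet (call union_ [:: var 0; var 2])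
      (HIf (call mem_ [:: var 0; var 2]) (HCons (var 0) (var 2)) (var 2))).
Definition traces_ : hl :=
  HFold 0 (HCons (call zeros_ [:: var 1]) HNil) (call zip_ [:: var 1; var 0])
    (HIf fst_ (var 1) (call extend_ [:: call diff_ [:: snd_; var 3]; var 1])).

(* Arguments: the graph and the set [A]. *)
Definition init_ : hl :=
  HFold 1 HNil (call traces_ [:: var 0; call compl_ [:: var 1]])
    (HFold 0
      (HIf (call subset_ [:: var 3; var 0]) (var 1)
        (call putmin_ [:: var 1; call cat_ [:: call zeros_ [:: var 3]; var 0]; HNil]))
      (call zip_ [:: var 3; var 2])
      (HIf fst_ (var 1)
        (call putmin_ [:: var 1;
          call cat_ [:: call diff_ [:: snd_; var 5]; var 2]; htrue]))).

(* Arguments: the accumulated table, then [X1], [X2], [Y], [A1], its table, [A2], its table. *)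
Definition join_step_ : hl :=
  hlet (call get_ [:: var 5; call cat_ [:: var 1;
         call inter_ [:: call union_ [:: var 2; var 3]; var 4]]])
  (hlet (call get_ [:: var 8; call cat_ [:: var 3;
         call inter_ [:: call union_ [:: var 2; var 4]; var 7]]])
    (HIf (var 1) (var 2) (HIf (var 0) (var 2)
      (call putmin_ [:: var 2;
         call cat_ [:: call diff_ [:: call union_ [:: var 3; var 4];
                                      call union_ [:: var 6; var 8]]; var 5];
         call cat_ [:: HTl (var 1); HTl (var 0)]])))).

(* Arguments: the graph, [A1], its table, [A2], its table. *)
Definition join_ : hl :=
  hlet (call traces_ [:: var 0; call compl_ [:: call union_ [:: var 1; var 3]]])
  (hlet (call traces_ [:: var 1; var 4])
  (hlet (call traces_ [:: var 2; var 3])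
    (HFold 1 HNil (var 0)
      (HFold 1 (var 1) (var 3)
        (HFold 1 (var 1) (var 6)
          (call join_step_ [:: var 1; var 4; var 2; var 0; var 10; var 11; var 12; var 13])))))).

Section Calls.
Variables L M : nat.
Notation yields := (yields L M).

Lemma yields_var i d u : dhd (iter i dtl d) = u -> yields (var i) d u.
Proof.
move=> <-; split; first by elim: i.
by rewrite /var /=; congr dhd; elim: i => //= i ->.
Qed.

Lemma yields_let a b d u v : yields a d u -> yields b (Cons u d) v -> yields (hlet a b) d v.
Proof. by move=> Ea; apply: yields_comp; apply: yields_cons Ea (yields_env _ _ _). Qed.

Lemma yields_call f s d u v : yields (foldr HCons HNil s) d u -> yields f u v -> yields (call f s) d v.
Proof. exact: yields_comp. Qed.

Lemma yields_true d : yields htrue d (enc_bool true). Proof. by []. Qed.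

End Calls.

(** Follows the syntax of straight-line code. The subgoals left are the programs called, each to be
    closed by its specification, and the conditionals and loops. *)
Ltac ev :=
  lazymatch goal with
  | |- yields _ _ (var _) _ _ => apply: yields_var; cbn [iter dhd dtl]; reflexivity
  | |- yields _ _ fst_ _ _ => rewrite /fst_; ev
  | |- yields _ _ snd_ _ _ => rewrite /snd_; ev
  | |- yields _ _ (HHd _) _ _ => try solve [eapply yields_hd; ev]
  | |- yields _ _ (HTl _) _ _ => try solve [eapply yields_tl; ev]
  | |- yields _ _ HEnv _ _ => apply: yields_env
  | |- yields _ _ HNil _ _ => apply: yields_nil
  | |- yields _ _ htrue _ _ => apply: yields_true
  | |- yields _ _ (HCons _ _) _ _ => eapply yields_cons; [ev|ev]
  | |- yields _ _ (call _ _) _ _ => eapply yields_call; [cbn [foldr]; ev|]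
  | |- _ => idtac
  end.

Section ListPrograms.
Variables L M : nat.
Notation yields := (yields L M).

Lemma yields_fold0 (X : Type) (g : X -> data) (s : seq X) (F : seq X -> data) i l f d :
  yields l d (enc_seq [seq g x | x <- s]) -> yields i d (F [::]) -> size s <= L ->
  (forall s1 x s2, s = s1 ++ x :: s2 ->
     yields f (Cons (g x) (Cons (F s2) d)) (F (x :: s2))) ->
  yields (HFold 0 i l f) d (F s).
Proof. by move=> El Ei sz; apply: yields_fold El Ei _; rewrite expn0 muln1. Qed.

Lemma yields_fold_data (s : seq data) (F : seq data -> data) i l f d :
  yields l d (enc_seq s) -> yields i d (F [::]) -> size s <= L ->
  (forall s1 x s2, s = s1 ++ x :: s2 ->
     yields f (Cons x (Cons (F s2) d)) (F (x :: s2))) ->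
  yields (HFold 0 i l f) d (F s).
Proof. by rewrite -{1}[s]map_id; apply: yields_fold0. Qed.

Lemma rcons_spec s x : size s <= L -> yields rcons_ [env enc_seq s; x] (enc_seq (rcons s x)).
Proof.
by move=> sz; apply: (yields_fold_data (F := fun s => enc_seq (rcons s x))) sz _ => *; ev.
Qed.

Lemma rev_spec s : size s <= L -> yields rev_ [env enc_seq s] (enc_seq (rev s)).
Proof.
move=> sz; apply: (yields_fold_data (F := fun s => enc_seq (rev s))) (sz) _; ev.
move=> s1 x s2 es; rewrite rev_cons; ev; apply: rcons_spec.
by rewrite size_rev; move: sz; rewrite es size_cat /=; lia.
Qed.

Lemma cat_spec s t : size s <= L -> yields cat_ [env enc_seq s; enc_seq t] (enc_seq (s ++ t)).
Proof.
by move=> sz; apply: (yields_fold_data (F := fun s => enc_seq (s ++ t))) sz _ => *; ev.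
Qed.

Lemma zip_spec (X : Type) (f g : X -> data) s : size s <= L ->
  yields zip_ [env enc_seq [seq f x | x <- s]; enc_seq [seq g x | x <- s]]
    (enc_seq [seq Cons (f x) (g x) | x <- s]).
Proof.
move=> sz; set t := [seq g x | x <- s].
apply: (@yields_hd _ _ _ _ _ (enc_seq (drop (size s) (rev t)))).
apply: (yields_fold0 (g := f) (F := fun s2 =>
  Cons (enc_seq [seq Cons (f x) (g x) | x <- s2])
       (enc_seq (drop (size s2) (rev t))))) (sz) _; ev.
  by rewrite drop0; apply: rev_spec; rewrite size_map.
move=> s1 x s2 es.
have et : drop (size s2) (rev t) = g x :: drop (size (x :: s2)) (rev t).
  rewrite /t es map_cat /= rev_cat rev_cons cat_rcons.
  rewrite -[size s2](size_map g) -size_rev drop_size_cat //.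
  by rewrite -[_.+1]addn1 addnC -drop_drop drop_size_cat // /= drop0.
by rewrite et; ev.
Qed.

Lemma enc_natE n : enc_nat n = enc_seq (nseq n Nil).
Proof. by elim: n => //= n <-. Qed.

Lemma yields_pred a d m : yields a d (enc_nat m) -> yields (HTl a) d (enc_nat m.-1).
Proof. by case: m => [|m]; apply: yields_dtl. Qed.

Lemma sub_spec m p : p <= L -> yields sub_ [env enc_nat m; enc_nat p] (enc_nat (m - p)).
Proof.
move=> sz; rewrite -{2}(size_nseq p Nil).
apply: (yields_fold_data (F := fun s => enc_nat (m - size s))); rewrite ?size_nseq //.
- by rewrite -enc_natE; ev.
- by rewrite subn0; ev.
by move=> s1 x s2 _; rewrite /= subnS; apply: yields_pred; ev.
Qed.

Lemma yields_if_nat a b c d m v : yields a d (enc_nat m) ->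
  (m = 0 -> yields b d v) -> (0 < m -> yields c d v) -> yields (HIf a b c) d v.
Proof.
by case: m => [|m] Ea Hb Hc; [apply: yields_if_nil Ea _; apply: Hb|apply: yields_if_cons Ea _; apply: Hc].
Qed.

Lemma eqn_spec m p : m <= L -> p <= L ->
  yields eqn_ [env enc_nat m; enc_nat p] (enc_bool (m == p)).
Proof.
move=> mL pL; apply: yields_if_nat; [ev; exact: sub_spec| |].
  move=> mp; apply: yields_if_nat; [ev; exact: sub_spec| |] => pm.
    have -> : m == p by lia.
    by ev.
  have -> : (m == p) = false by lia.
  by ev.
move=> mp; have -> : (m == p) = false by lia.
by ev.
Qed.

Lemma zeros_spec s : size s <= L -> yields zeros_ [env enc_seq s] (enc_nat (size s)).
Proof.
by move=> sz; apply: (yields_fold_data (F := fun s => enc_nat (size s))) sz _ => *; ev.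
Qed.

Lemma indices_spec s : size s <= L ->
  yields indices_ [env enc_seq s] (enc_seq [seq enc_nat i | i <- iota 0 (size s)]).
Proof.
move=> sz; apply: (@yields_hd _ _ _ _ _ Nil).
pose F (s2 : seq data) := Cons (enc_seq [seq enc_nat i | i <- iota (size s - size s2) (size s2)])
                  (enc_nat ((size s).-1 - size s2)).
have -> : Cons (enc_seq [seq enc_nat i | i <- iota 0 (size s)]) Nil = F s.
  by rewrite /F subnn; have -> : (size s).-1 - size s = 0 by lia.
apply: (yields_fold_data (F := F)) (sz) _; rewrite /F; ev.
  by rewrite subn0; apply: yields_pred; ev; apply: zeros_spec.
move=> s1 x s2 es; have sE : size s = (size s1 + size s2).+1.
  by rewrite es size_cat /=; lia.
have -> : (size s).-1 - size (x :: s2) = ((size s).-1 - size s2).-1.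
  by rewrite /=; lia.
have -> : size s - size (x :: s2) = (size s).-1 - size s2 by rewrite /=; lia.
have -> : iota ((size s).-1 - size s2) (size (x :: s2)) =
    ((size s).-1 - size s2) :: iota (size s - size s2) (size s2).
  by rewrite /=; congr (_ :: iota _ _); lia.
by apply: yields_cons; [ev|apply: yields_pred; ev].
Qed.

Lemma yields_behead a d s : yields a d (enc_seq s) -> yields (HTl a) d (enc_seq (behead s)).
Proof. by case: s => [|x s]; apply: yields_dtl. Qed.

(** * Binary tries *)

Definition enc_key (s : seq bool) : data := enc_seq [seq enc_bool b | b <- s].

Definition branch (b : bool) (t : data) : data := if b then dtl t else dhd t.
Definition set_branch (b : bool) (t u : data) : data :=
  if b then Cons (dhd t) u else Cons u (dtl t).

Definition tget (t : data) (key : seq bool) : data := foldr branch t key.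
Fixpoint tput (t : data) (key : seq bool) (x : data) : data :=
  if key is b :: key' then tput t key' (set_branch b (tget t key') x) else x.

(** Keys of equal length lead to distinct positions of which none is above another. *)
Lemma tget_put t key key' x : size key = size key' ->
  tget (tput t key x) key' = if key == key' then x else tget t key'.
Proof.
elim: key key' x => [|b key IH] [|b' key'] //= x [sz].
rewrite (IH _ _ sz) eqseq_cons; have [<-|_] := eqVneq key key'; last by rewrite andbF.
by case: b b' => [] [].
Qed.

Lemma get_spec t key : size key <= L -> yields get_ [env t; enc_key key] (tget t key).
Proof.
move=> sz; apply: (yields_fold0 (g := enc_bool)) sz _; ev.
move=> s1 [] s2 _ /=.
  by eapply yields_if_cons; [ev|apply: yields_dtl; ev].
by eapply yields_if_nil; [ev|apply: yields_dhd; ev].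
Qed.

Fixpoint tpath (t : data) (key : seq bool) : seq (bool * data) :=
  if key is b :: key' then (b, tget t key') :: tpath t key' else [::].

Lemma size_tpath t key : size (tpath t key) = size key.
Proof. by elim: key => //= b key ->. Qed.

Let enc_step (p : bool * data) := Cons (enc_bool p.1) p.2.

Lemma path_spec t key : size key <= L ->
  yields path_ [env t; enc_key key] (enc_seq [seq enc_step p | p <- tpath t key]).
Proof.
move=> sz; apply: (@yields_tl _ _ _ _ (tget t key)).
apply: (yields_fold0 (g := enc_bool) (F := fun key =>
  Cons (tget t key) (enc_seq [seq enc_step p | p <- tpath t key]))) sz _; ev.
move=> s1 b s2 _ /=; apply: yields_cons; last by ev.
case: b; first by eapply yields_if_cons; [ev|apply: yields_dtl; ev].
by eapply yields_if_nil; [ev|apply: yields_dhd; ev].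
Qed.

Lemma put_spec t key x : size key <= L ->
  yields put_ [env t; enc_key key; x] (tput t key x).
Proof.
move=> sz; pose h (p : bool * data) acc := set_branch p.1 p.2 acc.
have -> : tput t key x = foldr h x (rev (tpath t key)).
  by rewrite -(foldl_rev (fun acc p => h p acc)) revK; elim: key x {sz} => //= b key IH x; rewrite IH.
apply: (yields_fold0 (g := enc_step)); rewrite ?size_rev ?size_tpath //; ev.
- by apply: path_spec.
- by rewrite map_rev; apply: rev_spec; rewrite size_map size_tpath.
move=> s1 [b u] s2 _ /=; case: b; rewrite /h /enc_step /=.
  eapply yields_if_cons; [by ev|apply: yields_cons; ev].
  by apply: yields_dhd; ev.
eapply yields_if_nil; [by ev|apply: yields_cons; ev].
by apply: yields_dtl; ev.
Qed.

Definition enc_onat (o : option nat) : data :=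
  if o is Some m then Cons Nil (enc_nat m) else Nil.

(** The comparison loops over the stored value in unary, whence the bound [L] on it. Later this
    bound is carried along as [bounded]. *)
Lemma putmin_spec t key (m : nat) o : tget t key = enc_onat o ->
  oapp (fun m0 => m0 <= L) true o -> size key <= L ->
  yields putmin_ [env t; enc_key key; enc_nat m]
    (if o is Some m0 then if m <= m0 then tput t key (enc_onat (Some m)) else t
     else tput t key (enc_onat (Some m))).
Proof.
move=> gk oL sz; eapply yields_let; first by ev; apply: get_spec.
rewrite gk; case: o {gk} oL => [m0|] /= m0L; last first.
  by eapply yields_if_nil; ev; apply: put_spec.
eapply yields_if_cons; first by ev.
apply: yields_if_nat; first by ev; apply: sub_spec.
  by move/eqP; rewrite subn_eq0 => ->; ev; apply: put_spec.
by rewrite subn_gt0 ltnNge => /negPf->; ev.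
Qed.

End ListPrograms.

(** * Set programs *)

Section SetSpecs.
Variables (L M : nat) (V : finType) (e : rel V).
Notation yields := (yields L M).
Hypothesis VL : (#|V|).*2 <= L.
Implicit Types A B C X Y : {set V}.

Lemma cardVL : size (enum V) <= L.
Proof. by rewrite -cardE; apply: leq_trans VL; rewrite -addnn leq_addr. Qed.

Definition bits (A : {set V}) : data := enc_seq [seq enc_bool (x \in A) | x <- enum V].

Lemma yields_fold1 (X : Type) (g : X -> data) (s : seq X) (F : seq X -> data) i l f d :
  0 < L -> yields l d (enc_seq [seq g x | x <- s]) -> yields i d (F [::]) -> size s <= M ->
  (forall s1 x s2, s = s1 ++ x :: s2 ->
     yields f (Cons (g x) (Cons (F s2) d)) (F (x :: s2))) ->
  yields (HFold 1 i l f) d (F s).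
Proof.
move=> L0 El Ei sz; apply: yields_fold El Ei _; rewrite expn1.
by apply: leq_trans sz _; apply: leq_pmull.
Qed.

Lemma bitwise_spec f F A B C :
  (forall p q d, yields f (Cons (Cons (enc_bool p) (enc_bool q)) d) (enc_bool (F p q))) ->
  (forall x, F (x \in A) (x \in B) = (x \in C)) ->
  yields (bitwise_ f) [env bits A; bits B] (bits C).
Proof.
move=> Ef FC; apply: (yields_fold0 (g := fun x => Cons (enc_bool (x \in A)) (enc_bool (x \in B)))
  (F := fun s => enc_seq [seq enc_bool (x \in C) | x <- s])) cardVL _; ev.
  exact: zip_spec cardVL.
by move=> s1 x s2 _; rewrite /= -FC; apply: yields_cons; [apply: Ef|ev].
Qed.

Lemma union_spec A B : yields union_ [env bits A; bits B] (bits (A :|: B)).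
Proof.
apply: (@bitwise_spec _ orb) => [p q d|x]; last by rewrite inE.
by case: p; [eapply yields_if_cons|apply: yields_if_nil]; ev.
Qed.

Lemma inter_spec A B : yields inter_ [env bits A; bits B] (bits (A :&: B)).
Proof.
apply: (@bitwise_spec _ andb) => [p q d|x]; last by rewrite inE.
by case: p; [eapply yields_if_cons|apply: yields_if_nil]; ev.
Qed.

Lemma diff_spec A B : yields diff_ [env bits A; bits B] (bits (A :\: B)).
Proof.
apply: (@bitwise_spec _ (fun p q => ~~ q && p)) => [p q d|x]; last by rewrite inE.
by case: q; [eapply yields_if_cons|apply: yields_if_nil]; ev.
Qed.

Lemma compl_spec A : yields compl_ [env bits A] (bits (~: A)).
Proof.
apply: (yields_fold0 (g := fun x => enc_bool (x \in A))
  (F := fun s => enc_seq [seq enc_bool (x \in ~: A) | x <- s])) cardVL _; ev.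
move=> s1 x s2 _; rewrite /= inE; apply: yields_cons; last by ev.
by case: (x \in A); [eapply yields_if_cons|apply: yields_if_nil]; ev.
Qed.

Lemma subset_spec A B : yields subset_ [env bits A; bits B] (enc_bool (A \subset B)).
Proof.
have -> : (A \subset B) = all (fun x => (x \in A) ==> (x \in B)) (enum V).
  apply/subsetP/allP=> [AB x _|AB x xA]; first by apply/implyP/AB.
  by apply: (implyP (AB x _)); rewrite // mem_enum.
apply: (yields_fold0 (g := fun x => Cons (enc_bool (x \in A)) (enc_bool (x \in B)))
  (F := fun s => enc_bool (all _ s))) cardVL _; ev.
  exact: zip_spec cardVL.
move=> s1 x s2 _ /=; case: (x \in A); last by eapply yields_if_nil; ev.
eapply yields_if_cons; first by ev.
by case: (x \in B); [eapply yields_if_cons|apply: yields_if_nil]; ev.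
Qed.

Lemma eqset_spec A B : yields eqset_ [env bits A; bits B] (enc_bool (A == B)).
Proof.
have AB := subset_spec A B; have BA := subset_spec B A.
rewrite eqEsubset; case: (A \subset B) AB => AB.
  by eapply yields_if_cons; ev; apply: AB || apply: BA.
by eapply yields_if_nil; ev; apply: AB.
Qed.

Lemma mem_spec A (s : seq {set V}) : 0 < L -> size s <= M ->
  yields mem_ [env bits A; enc_seq [seq bits B | B <- s]] (enc_bool (A \in s)).
Proof.
move=> L0 sz; apply: (yields_fold1 (F := fun s : seq {set V} => enc_bool (A \in s)) L0) sz _; ev.
move=> s1 B s2 _; rewrite inE eq_sym; have := eqset_spec B A.
by case: eqP => _ BA; [eapply yields_if_cons|eapply yields_if_nil]; ev; apply: BA.
Qed.

Definition add_set (z : {set V}) (y : {set V}) (s : seq {set V}) : seq {set V} :=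
  if y :|: z \in s then s else (y :|: z) :: s.

Definition extend (z : {set V}) (s t : seq {set V}) : seq {set V} := foldr (add_set z) s t.

Lemma mem_extend z s t X :
  (X \in extend z s t) = (X \in s) || (X \in [seq y :|: z | y <- t]).
Proof.
elim: t => [|y t IH] /=; first by rewrite orbF.
rewrite inE orbCA -IH /add_set; case: ifP => [yz|_]; last by rewrite inE.
by case: eqVneq => // ->.
Qed.

Lemma uniq_extend z s t : uniq s -> uniq (extend z s t).
Proof. by move=> us; elim: t => //= y t; rewrite /add_set; case: ifP => //= ->. Qed.

Lemma extend_spec z (s : seq {set V}) : 0 < L -> uniq s -> size (extend z s s) <= M ->
  yields extend_ [env bits z; enc_seq [seq bits B | B <- s]]
    (enc_seq [seq bits B | B <- extend z s s]).
Proof.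
move=> L0 us sz.
(* The intermediate lists are free of duplicates and contained in the final one, whose length is
   bounded by hypothesis. *)
have szt s1 s2 : s = s1 ++ s2 -> size (extend z s s2) <= M.
  move=> es; apply: leq_trans sz; apply: uniq_leq_size; first exact: uniq_extend.
  move=> X; rewrite !mem_extend => /orP[->//|/mapP[y ys ->]].
  by apply/orP; right; apply/mapP; exists y => //; rewrite es mem_cat ys orbT.
have sz0 : size s <= M by apply: (szt s [::]); rewrite cats0.
apply: (yields_fold1 (F := fun t => enc_seq [seq bits B | B <- extend z s t]) L0) (sz0) _; ev.
move=> s1 y s2 es /=; eapply yields_let; first by ev; apply: union_spec.
have sz2 : size (extend z s s2) <= M by apply: (szt (rcons s1 y)); rewrite cat_rcons.
have := mem_spec (y :|: z) L0 sz2; rewrite /add_set.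
by case: ifP => yz Em; [eapply yields_if_cons|eapply yields_if_nil]; ev; apply: Em.
Qed.

Definition trace_seq (A : {set V}) (s : seq V) : seq {set V} :=
  foldr (fun x t => if x \in A then extend (nbh e x :\: A) t t else t) [:: set0] s.

Lemma uniq_trace_seq A s : uniq (trace_seq A s).
Proof. by elim: s => //= x s us; case: ifP => // _; apply: uniq_extend. Qed.

Lemma mem_trace_seq A s X :
  reflect (exists S : {set V}, [/\ S \subset A, {subset S <= s} & X = nbhs e S :\: A])
          (X \in trace_seq A s).
Proof.
elim: s X => [|x s IH] X /=.
  rewrite inE; apply: (iffP eqP) => [->|[S [_ S0 ->]]].
    by exists set0; split=> [|x|]; rewrite ?sub0set ?inE // nbhs0 set0D.
  have -> : S = set0 by apply/setP=> x; rewrite inE; apply/negP=> /S0.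
  by rewrite nbhs0 set0D.
have sub S : {subset S <= s} -> {subset S <= x :: s}.
  by move=> Ss y /Ss; rewrite inE orbC => ->.
case: ifP => xA; last first.
  apply: (iffP (IH X)) => -[S [SA Ss ->]]; exists S; split=> //; first exact: sub.
  move=> y yS; have := Ss _ yS; rewrite inE; case/orP=> // /eqP ey.
  by have := subsetP SA _ yS; rewrite ey xA.
rewrite mem_extend; apply: (iffP orP) => [[/IH[S [SA Ss ->]]|/mapP[Y /IH[S [SA Ss ->]] ->]]|].
- by exists S; split=> //; apply: sub.
- exists (S :|: [set x]); split; first by rewrite subUset SA sub1set.
    by move=> y; rewrite !inE => /orP[/Ss->|->]; rewrite ?orbT.
  by rewrite nbhsU nbhs1 setDUl.
case=> S [SA Ss ->]; have [xS|xS] := boolP (x \in S); [right|left].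
  apply/mapP; exists (nbhs e (S :\ x) :\: A); last first.
    by rewrite -setDUl -nbhs1 -nbhsU setUC setD1K.
  apply/IH; exists (S :\ x); split=> //; first by apply: subset_trans SA; apply: subD1set.
  by move=> y; rewrite !inE => /andP[yx /Ss]; rewrite inE (negPf yx).
apply/IH; exists S; split=> // y yS; have := Ss _ yS; rewrite inE.
by case/orP=> // /eqP ey; rewrite -ey yS in xS.
Qed.

Definition trace_list A : seq {set V} := trace_seq A (enum V).

Lemma mem_trace_list A : trace_list A =i traces e A.
Proof.
move=> X; apply/mem_trace_seq/tracesP=> [[S [SA _ ->]]|[S SA ->]]; exists S => //.
by split=> // x _; rewrite mem_enum.
Qed.

Lemma size_trace_seq A s : size (trace_seq A s) <= #|traces e A|.
Proof.
rewrite cardE; apply: uniq_leq_size (uniq_trace_seq A s) _ => X.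
by case/mem_trace_seq=> S [SA _ ->]; rewrite mem_enum; apply/tracesP; exists S.
Qed.

Definition graph : data := enc_seq [seq bits (nbh e x) | x <- enum V].

Lemma graphE : graph = enc_graph e.
Proof.
congr enc_seq; apply: eq_map => x; congr enc_seq; apply: eq_map => y.
by rewrite inE.
Qed.

Lemma zeros_bits s : enc_nat (size s) = enc_seq [seq enc_bool (x \in (set0 : {set V})) | x <- s].
Proof. by elim: s => //= x s ->; rewrite inE. Qed.

Lemma zeros_set_spec (g : V -> data) :
  yields zeros_ [env enc_seq [seq g x | x <- enum V]] (bits set0).
Proof.
rewrite /bits -zeros_bits -(size_map g); apply: zeros_spec; rewrite size_map; exact: cardVL.
Qed.

Lemma traces_spec A : 0 < L -> #|traces e A| <= M ->
  yields traces_ [env graph; bits A] (enc_seq [seq bits B | B <- trace_list A]).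
Proof.
move=> L0 tM.
apply: (yields_fold0 (g := fun x => Cons (enc_bool (x \in A)) (bits (nbh e x)))
  (F := fun s => enc_seq [seq bits B | B <- trace_seq A s])) cardVL _; ev.
- exact: zip_spec cardVL.
- exact: zeros_set_spec.
move=> s1 x s2 _ /=; have sz := leq_trans (size_trace_seq A (x :: s2)) tM.
move: sz => /=; case: (x \in A) => sz; last by apply: yields_if_nil; ev.
eapply yields_if_cons; first by ev.
by ev; [apply: diff_spec|apply: extend_spec (uniq_trace_seq _ _) sz].
Qed.

Definition key (X Y : {set V}) : seq bool :=
  [seq x \in X | x <- enum V] ++ [seq x \in Y | x <- enum V].

Lemma size_key X Y : size (key X Y) <= L.
Proof. by rewrite /key size_cat 2!size_map -cardE addnn. Qed.

Lemma key_inj X Y X' Y' : (key X Y == key X' Y') = (X' == X) && (Y' == Y).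
Proof.
have inj A B : ([seq x \in A | x <- enum V] == [seq x \in B | x <- enum V]) = (B == A).
  apply/eqP/eqP=> [|->//] /eq_in_map eAB; apply/setP=> x.
  by rewrite eAB // mem_enum.
by rewrite eqseq_cat ?size_map // !inj.
Qed.

Lemma key_spec X Y : yields cat_ [env bits X; bits Y] (enc_key (key X Y)).
Proof.
rewrite /enc_key /key /bits map_cat -[X in X ++ _]map_comp -[X in _ ++ X]map_comp.
by apply: cat_spec; rewrite size_map; apply: cardVL.
Qed.

(** Only the keys of pairs of sets are constrained, so a table has many representing tries. *)
Definition represents (t : data) (f : table V) : Prop :=
  forall X Y, tget t (key X Y) = enc_onat (f X Y).

Definition bounded (f : table V) : Prop := forall X Y m, f X Y = Some m -> m <= L.

Lemma represents0 : represents Nil (@no_table V).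
Proof. by move=> X Y; rewrite /tget; elim: (key X Y) => //= -[] s ->. Qed.

Lemma get_table_spec t f X Y : represents t f ->
  yields get_ [env t; enc_key (key X Y)] (enc_onat (f X Y)).
Proof. by move=> tf; rewrite -tf; apply: get_spec (size_key X Y). Qed.

Lemma putmin_table_spec t f X Y (m : nat) : represents t f -> bounded f ->
  exists2 t', yields putmin_ [env t; enc_key (key X Y); enc_nat m] t' &
              represents t' (update f X Y m).
Proof.
move=> tf bf; have fL : oapp (fun m0 => m0 <= L) true (f X Y).
  by case ef: (f X Y) => [m0|] //; apply: bf ef.
eexists; first exact: (putmin_spec M m (tf X Y) fL (size_key X Y)).
have put (n : nat) X' Y' : tget (tput t (key X Y) (enc_onat (Some n))) (key X' Y') =
    enc_onat (if (X' == X) && (Y' == Y) then Some n else f X' Y').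
  rewrite tget_put /key ?size_cat ?size_map // key_inj tf.
  by case: ifP.
move=> X' Y'; rewrite /update; case: (f X Y) (tf X Y) => [m0|] tXY; last by rewrite put.
case: ifP => _; first by rewrite put.
by case: andP => [[/eqP -> /eqP ->]|_].
Qed.

Lemma bounded_update f X Y (m : nat) : m <= L -> bounded f -> bounded (update f X Y m).
Proof.
move=> mL bf X' Y' m'; rewrite /update; case: ifP => _; last exact: bf.
case=> <-; case ef: (f X Y) => [m0|] //; case: ifP => // _; exact: bf ef.
Qed.

Definition tabulates (f : table V) (t : data) : Prop := represents t f /\ bounded f.

Lemma tabulates0 : tabulates (@no_table V) Nil.
Proof. by split; first exact: represents0. Qed.

Lemma putmin_tabulates t f X Y (m : nat) : m <= L -> tabulates f t ->
  exists2 t', yields putmin_ [env t; enc_key (key X Y); enc_nat m] t' &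
              tabulates (update f X Y m) t'.
Proof.
move=> mL [tf bf]; have [t' Et' tf'] := putmin_table_spec X Y m tf bf.
by exists t' => //; split=> //; apply: bounded_update.
Qed.

Lemma yields_fold1_ex (X : Type) (g : X -> data) (s : seq X) (R : seq X -> data -> Prop)
    i l f d a :
  0 < L -> yields l d (enc_seq [seq g x | x <- s]) -> yields i d a -> size s <= M -> R [::] a ->
  (forall s1 x s2 acc, s = s1 ++ x :: s2 -> R s2 acc ->
     exists2 v, yields f (Cons (g x) (Cons acc d)) v & R (x :: s2) v) ->
  exists2 v, yields (HFold 1 i l f) d v & R s v.
Proof.
move=> L0 El Ei sz; apply: yields_fold_ex El Ei _; rewrite expn1.
by apply: leq_trans sz _; apply: leq_pmull.
Qed.

Lemma yields_fold0_ex (X : Type) (g : X -> data) (s : seq X) (R : seq X -> data -> Prop)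
    i l f d a :
  yields l d (enc_seq [seq g x | x <- s]) -> yields i d a -> size s <= L -> R [::] a ->
  (forall s1 x s2 acc, s = s1 ++ x :: s2 -> R s2 acc ->
     exists2 v, yields f (Cons (g x) (Cons acc d)) v & R (x :: s2) v) ->
  exists2 v, yields (HFold 0 i l f) d v & R s v.
Proof. by move=> El Ei sz; apply: yields_fold_ex El Ei _; rewrite expn0 muln1. Qed.

Lemma size_trace_list A : size (trace_list A) <= #|traces e A|.
Proof. exact: size_trace_seq. Qed.

Lemma init_spec A : 0 < L -> #|traces e (~: A)| <= M ->
  exists2 t, yields init_ [env graph; bits A] t &
             tabulates (init_table e A (trace_list (~: A))) t.
Proof.
move=> L0 tM; have szM := leq_trans (size_trace_list _) tM.
apply: (yields_fold1_ex (g := bits) (R := fun s => tabulates (init_table e A s)) (a := Nil)) => //.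
- by ev; [apply: compl_spec|apply: traces_spec].
- exact: tabulates0.
move=> s1 Y s2 acc _ tacc.
pose f0 := if A \subset Y then update (init_table e A s2) set0 Y 0 else init_table e A s2.
have [t0 Et0 tf0] : exists2 t0, yields
    (HIf (call subset_ [:: var 3; var 0]) (var 1)
      (call putmin_ [:: var 1; call cat_ [:: call zeros_ [:: var 3]; var 0]; HNil]))
    (Cons (bits Y) (Cons acc [env graph; bits A])) t0 & tabulates f0 t0.
  have := subset_spec A Y; rewrite /f0; case: ifP => AY EAY.
    have [t' Et' tf'] := putmin_tabulates set0 Y (leq0n L) tacc.
    exists t' => //; eapply yields_if_cons; first by ev; apply: EAY.
    by ev; [exact: zeros_set_spec|exact: key_spec|exact: Et'].
  by exists acc => //; eapply yields_if_nil; ev; apply: EAY.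
apply: (yields_fold0_ex (g := fun x => Cons (enc_bool (x \in A)) (bits (nbh e x)))
  (R := fun s => tabulates (foldr (fun x f =>
     if x \in A then update f (nbh e x :\: A) Y 1 else f) f0 s)) _ Et0 cardVL tf0).
  by ev; exact: zip_spec cardVL.
move=> r1 x r2 acc' _ tacc' /=.
case: (x \in A); last by exists acc' => //; eapply yields_if_nil; ev.
have [t' Et' tf'] := putmin_tabulates (nbh e x :\: A) Y L0 tacc'.
exists t' => //; eapply yields_if_cons; first by ev.
by ev; [exact: diff_spec|exact: key_spec|exact: Et'].
Qed.

(** Sharper than [bounded], and a consequence of soundness: the sum of two entries must not exceed
    [L], which is at least [2 * #|V|]. *)
Definition small (f : table V) : Prop := forall X Y m, f X Y = Some m -> m <= #|V|.

Lemma table_ok_small A f : table_ok e A f -> small f.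
Proof. by case=> sf _ X Y m /sf[S [_ <- _ _]]; apply: max_card. Qed.

Section Join.
Variables (A1 A2 : {set V}) (t1 t2 : data) (f1 f2 : table V).
Hypotheses (tf1 : represents t1 f1) (tf2 : represents t2 f2).
Hypotheses (sf1 : small f1) (sf2 : small f2).

Lemma join_step_spec acc f X1 X2 Y : tabulates f acc ->
  exists2 t, yields join_step_ [env acc; bits X1; bits X2; bits Y; bits A1; t1; bits A2; t2] t &
    tabulates (update_opt f (join_X (A1 :|: A2) X1 X2) Y (join_v A1 A2 f1 f2 X1 X2 Y)) t.
Proof.
move=> tacc.
have get1 := get_table_spec X1 ((X2 :|: Y) :&: A1) tf1.
have get2 := get_table_spec X2 ((X1 :|: Y) :&: A2) tf2.
rewrite /join_v.
case e1: (f1 _ _) get1 => [m1|] get1.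
- case e2: (f2 _ _) get2 => [m2|] get2 /=.
  + have mL : m1 + m2 <= L.
      by apply: leq_trans VL; rewrite -addnn leq_add ?(sf1 e1) ?(sf2 e2).
    have [t Et tf] := putmin_tabulates (join_X (A1 :|: A2) X1 X2) Y mL tacc.
    exists t => //.
    eapply yields_let; first by ev; [exact: union_spec|exact: inter_spec|exact: key_spec|exact: get1].
    eapply yields_let; first by ev; [exact: union_spec|exact: inter_spec|exact: key_spec|exact: get2].
    eapply yields_if_cons; first by ev.
    eapply yields_if_cons; first by ev.
    ev; [exact: union_spec|exact: union_spec|exact: diff_spec|exact: key_spec| |exact: Et].
    rewrite !enc_natE nseqD; apply: cat_spec; rewrite size_nseq.
    by apply: leq_trans mL; apply: leq_addr.
  + exists acc => //.
    eapply yields_let; first by ev; [exact: union_spec|exact: inter_spec|exact: key_spec|exact: get1].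
    eapply yields_let; first by ev; [exact: union_spec|exact: inter_spec|exact: key_spec|exact: get2].
    by eapply yields_if_cons; ev; eapply yields_if_nil; ev.
- exists acc => //.
  eapply yields_let; first by ev; [exact: union_spec|exact: inter_spec|exact: key_spec|exact: get1].
  eapply yields_let; first by ev; [exact: union_spec|exact: inter_spec|exact: key_spec|exact: get2].
  by eapply yields_if_nil; ev.
Qed.

Lemma join_spec : 0 < L ->
  #|traces e A1| <= M -> #|traces e A2| <= M -> #|traces e (~: (A1 :|: A2))| <= M ->
  exists2 t, yields join_ [env graph; bits A1; t1; bits A2; t2] t &
    tabulates (join_table A1 A2 f1 f2 (trace_list A1) (trace_list A2)
                 (trace_list (~: (A1 :|: A2)))) t.
Proof.
move=> L0 M1 M2 MB.
have s1 := leq_trans (size_trace_list _) M1.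
have s2 := leq_trans (size_trace_list _) M2.
have sB := leq_trans (size_trace_list _) MB.
set d := [env graph; bits A1; t1; bits A2; t2].
pose lst A := enc_seq [seq bits B | B <- trace_list A].
set LB := trace_list (~: _) in sB *.
suff [t Et tf] : exists2 t, yields
    (HFold 1 HNil (var 0)
      (HFold 1 (var 1) (var 3)
        (HFold 1 (var 1) (var 6)
          (call join_step_ [:: var 1; var 4; var 2; var 0; var 10; var 11; var 12; var 13]))))
    (Cons (lst A1) (Cons (lst A2) (Cons (lst (~: (A1 :|: A2))) d))) t &
    tabulates (join_table A1 A2 f1 f2 (trace_list A1) (trace_list A2) LB) t.
  exists t; last exact: tf.
  rewrite /join_.
  eapply yields_let; first by ev; [exact: union_spec|exact: compl_spec|exact: traces_spec].
  eapply yields_let; first by ev; exact: traces_spec.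
  eapply yields_let; first by ev; exact: traces_spec.
  exact: Et.
apply: (yields_fold1_ex (g := bits) (a := Nil)
  (R := fun s => tabulates (join_table A1 A2 f1 f2 s (trace_list A2) LB))) => //.
  exact: tabulates0.
move=> r1 X1 r2 acc _ tacc /=.
pose step X1 X2 Y f := update_opt f (join_X (A1 :|: A2) X1 X2) Y (join_v A1 A2 f1 f2 X1 X2 Y).
apply: (yields_fold1_ex (g := bits) (a := acc)
  (R := fun s => tabulates (foldr (fun X2 f => foldr (fun Y f => step X1 X2 Y f) f LB)
     (join_table A1 A2 f1 f2 r2 (trace_list A2) LB) s))) => //.
move=> r3 X2 r4 acc2 _ tacc2.
set f0 := foldr _ _ r4 in tacc2.
apply: (yields_fold1_ex (g := bits) (a := acc2)
  (R := fun s => tabulates (foldr (fun Y f => step X1 X2 Y f) f0 s))) => //.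
move=> r5 Y r6 acc3 _ tacc3.
have [t Et tf] := join_step_spec X1 X2 Y tacc3.
by exists t => //; ev; exact: Et.
Qed.

End Join.
End SetSpecs.

(** * The algorithm *)

(* An active tree node [x] is represented by its number, its row of the adjacency
   matrix, the set [A] that has been gathered in [x], and the table of [A]. *)
Definition row_of (it : hl) : hl := HHd (HTl it).
Definition set_of (it : hl) : hl := HHd (HTl (HTl it)).
Definition table_of (it : hl) : hl := HTl (HTl (HTl it)).

Definition adj_ : hl := HHd (HFold 0 (row_of (var 0)) (HHd (var 1)) (HTl (var 1))).
Definition nbrs_ : hl :=
  HFold 0 HNil (var 1)
    (HIf (call adj_ [:: var 2; var 0]) (var 1) (HCons (var 0) (var 1))).
Definition candidate_ : hl :=
  HFold 0 HNil (HTl (var 0))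
    (hlet (call nbrs_ [:: var 0; var 2])
      (HIf (var 0) (var 2)
        (HIf (HTl (var 0)) (HCons (var 1) (HHd (var 0))) (var 2)))).
Definition merge_ : hl :=
  HCons (HHd (var 2)) (HCons (row_of (var 2))
    (HCons (call union_ [:: set_of (var 2); set_of (var 1)])
      (call join_ [:: var 0; set_of (var 2); table_of (var 2);
                      set_of (var 1); table_of (var 1)]))).
(** The order of the list is kept, so the root remains at its head. *)
Definition replace_ : hl :=
  HFold 0 HNil (var 2)
    (HIf (call eqn_ [:: HHd (var 0); HHd (var 2)])
      (HIf (call eqn_ [:: HHd (var 0); HHd (var 3)])
        (HCons (var 0) (var 1)) (HCons (var 3) (var 1)))
      (var 1)).
Definition step_ : hl :=
  hlet (call candidate_ [:: var 1])
    (HIf (var 0) (var 2)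
      (call replace_ [:: HHd (var 0);
         call merge_ [:: var 1; HHd (var 0); HTl (var 0)]; var 2])).
Definition items_ : hl :=
  HFold 0 HNil (call zip_ [:: call indices_ [:: var 1]; call zip_ [:: var 1; var 2]])
    (hlet (HIf (HTl (HTl (var 0))) (call zeros_ [:: var 2])
             (call unit_ [:: var 2; HTl (HTl (HTl (var 0)))]))
      (HCons (HCons (HHd (var 1)) (HCons (HHd (HTl (var 1)))
                (HCons (var 0) (call init_ [:: var 3; var 0]))))
        (var 2))).
(** The fold over the rows of the tree serves as a loop of [#|T|] rounds. A round removes one active
    node while several are left and changes nothing afterwards, so the root alone remains; its entry
    at two empty sets is the answer, and [HTl] strips the tag of a present entry. *)
Definition solve_ : hl :=
  hlet (HFold 0 (call items_ [:: var 0; var 1; var 2]) (var 1)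
         (call step_ [:: var 2; var 1]))
    (HTl (call get_ [:: table_of (HHd (var 0));
            call cat_ [:: call zeros_ [:: var 1]; call zeros_ [:: var 1]]])).
Definition main_ : hl :=
  call solve_ [:: HHd HEnv; HHd (HTl HEnv); HTl (HTl HEnv)].

Section Main.
Variables (L M : nat) (V T : finType) (e : rel V) (eT : rel T).
Notation yields := (yields L M).
Hypotheses (VL : (#|V|).*2 <= L) (TL : #|T| <= L) (L0 : 0 < L).

Lemma map_index_enum (X : finType) :
  [seq index x (enum X) | x <- enum X] = iota 0 (size (enum X)).
Proof.
apply: (@eq_from_nth _ 0) => [|i]; rewrite size_map ?size_iota // => lt.
case E0: (enum X) lt (enum_uniq X) => [//|x0 s] lt u.
by rewrite (nth_map x0) // nth_iota // index_uniq.
Qed.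

Lemma enc_index_enum (X : finType) :
  [seq enc_nat (index x (enum X)) | x <- enum X] =
  [seq enc_nat i | i <- iota 0 (size (enum X))].
Proof. by rewrite -map_index_enum -[RHS]map_comp. Qed.

Lemma index_enum_eq (X : finType) (x y : X) :
  (index x (enum X) == index y (enum X)) = (x == y).
Proof.
apply/eqP/eqP=> [|->//] ixy; rewrite -[x](@nth_index _ x _ (enum X)) ?mem_enum //.
by rewrite ixy nth_index ?mem_enum.
Qed.

Lemma index_le_card (X : finType) (x : X) : index x (enum X) <= #|X|.
Proof. by rewrite [#|X|]cardE index_size. Qed.

Definition row (x : T) : data := enc_seq [seq enc_bool (eT x y) | y <- enum T].

Definition item (A : {set V}) (t : data) (x : T) : data :=
  Cons (enc_nat (index x (enum T))) (Cons (row x) (Cons (bits A) t)).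

Lemma unit_spec (v : V) :
  yields unit_ [env graph e; enc_nat (enum_rank v)] (bits [set v]).
Proof.
have sz := cardVL VL.
apply: (yields_fold0 (g := fun x => enc_nat (index x (enum V)))
  (F := fun s => enc_seq [seq enc_bool (x \in [set v]) | x <- s])) sz _; ev.
  rewrite enc_index_enum -[size (enum V)](size_map (fun x => bits (nbh e x))).
  by apply: indices_spec; rewrite size_map; apply: cardVL VL.
move=> s1 x s2 _; apply: yields_cons; last by ev.
have -> : (x \in [set v]) = (index x (enum V) == enum_rank v).
  rewrite inE -index_enum_eq; congr (_ == _).
  by rewrite -{1}(nth_enum_rank v v) index_uniq ?enum_uniq // -cardE.
have VL' : #|V| <= L by apply: leq_trans VL; rewrite -addnn leq_addr.
ev; apply: eqn_spec; first exact: leq_trans (index_le_card _) VL'.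
exact: leq_trans (ltnW (ltn_ord _)) VL'.
Qed.

Section Items.
Variables (A : T -> {set V}) (tt : T -> data).
Let it (x : T) : data := item (A x) (tt x) x.

Lemma adj_spec x y : yields adj_ [env it x; it y] (enc_bool (eT x y)).
Proof.
set s := [seq enc_bool (eT x z) | z <- enum T].
have lt : index y (enum T) < size (enum T) by rewrite index_mem mem_enum.
apply: (@yields_hd _ _ _ _ _ (enc_seq (drop (index y (enum T)).+1 s))).
have -> : Cons (enc_bool (eT x y)) (enc_seq (drop (index y (enum T)).+1 s)) =
    enc_seq (drop (index y (enum T)) s).
  by rewrite /s [in RHS](drop_nth Nil) 1?size_map // (nth_map y) // nth_index ?mem_enum.
rewrite -(size_nseq (index y (enum T)) Nil).
apply: (yields_fold_data (F := fun s2 => enc_seq (drop (size s2) s))).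
- by rewrite -enc_natE /it /item; ev.
- by rewrite drop0 /row_of /it /item; ev.
- by rewrite size_nseq; apply: leq_trans (index_le_card _) TL.
move=> s1 z s2 _.
have -> : drop (size (z :: s2)) s = behead (drop (size s2) s).
  by rewrite -drop1 drop_drop.
by apply: yields_behead; ev.
Qed.

Lemma nbrs_spec W x : size W <= L ->
  yields nbrs_ [env it x; enc_seq [seq it y | y <- W]]
    (enc_seq [seq it y | y <- W & eT x y]).
Proof.
move=> sz; apply: (yields_fold0 (g := it)
  (F := fun W => enc_seq [seq it y | y <- W & eT x y])) sz _; ev.
move=> s1 y s2 _ /=; have := adj_spec x y.
by case: (eT x y) => adj; [eapply yields_if_cons|eapply yields_if_nil]; ev; apply: adj.
Qed.

Definition candidate (W s : seq T) : data :=
  foldr (fun x acc => if [seq y <- W | eT x y] is [:: p] then Cons (it x) (it p) else acc)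
    Nil s.

Lemma candidate_spec W : size W <= L ->
  yields candidate_ [env enc_seq [seq it y | y <- W]] (candidate W (behead W)).
Proof.
move=> sz; apply: (yields_fold0 (g := it) (F := candidate W)).
- by rewrite -behead_map; apply: yields_behead; ev.
- by ev.
- by rewrite size_behead; apply: leq_trans (leq_pred _) sz.
move=> s1 x s2 _ /=; have nb := nbrs_spec x sz.
eapply yields_let; first by ev; apply: nb.
case: [seq y <- W | eT x y] => [|p [|q w]] /=.
- by eapply yields_if_nil; ev.
- by eapply yields_if_cons; [ev|eapply yields_if_nil; ev].
- by eapply yields_if_cons; [ev|eapply yields_if_cons; ev].
Qed.

Lemma candidateP W s :
  (candidate W s = Nil /\ forall x, x \in s -> size [seq y <- W | eT x y] != 1) \/
  exists x p, [/\ x \in s, [seq y <- W | eT x y] = [:: p] &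
                  candidate W s = Cons (it x) (it p)].
Proof.
elim: s => [|x s IH] /=; first by left.
have IH' : size [seq y <- W | eT x y] != 1 ->
    (candidate W s = Nil /\ forall y, y \in x :: s -> size [seq z <- W | eT y z] != 1) \/
    exists y p, [/\ y \in x :: s, [seq z <- W | eT y z] = [:: p] &
                  candidate W s = Cons (it y) (it p)].
  move=> nx; case: IH => [[cN H]|[y [p [ys ep cE]]]]; [left|right].
    by split=> // y; rewrite inE => /predU1P[->//|/H].
  by exists y, p; split; rewrite // inE ys orbT.
case ex: [seq y <- W | eT x y] IH' => [|p [|q w]]; try by apply.
by move=> _; right; exists x, p; rewrite inE eqxx.
Qed.

Lemma replace_spec W x p B t : size W <= L ->
  yields replace_ [env it x; item B t p; enc_seq [seq it y | y <- W]]
    (enc_seq [seq if y == p then item B t p else it y | y <- W & y != x]).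
Proof.
move=> sz; pose g y := if y == p then item B t p else it y.
apply: (yields_fold0 (g := it)
  (F := fun W => enc_seq [seq g y | y <- W & y != x])) sz _; ev.
move=> s1 y s2 _ /=.
have iL z : index z (enum T) <= L := leq_trans (index_le_card z) TL.
have := eqn_spec M (iL y) (iL x); have := eqn_spec M (iL y) (iL p).
rewrite !index_enum_eq /g; case: (y == x) => ep ex /=.
  by eapply yields_if_cons; rewrite /it /item; ev; apply: ex.
eapply yields_if_nil; first by rewrite /it /item; ev; apply: ex.
by case: (y == p) ep => ep; [eapply yields_if_cons|eapply yields_if_nil];
  rewrite /it /item; ev; apply: ep.
Qed.

Lemma merge_spec x p f1 f2 :
  represents (tt p) f1 -> represents (tt x) f2 ->
  table_ok e (A p) f1 -> table_ok e (A x) f2 -> [disjoint A p & A x] ->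
  #|traces e (A p)| <= M -> #|traces e (A x)| <= M ->
  #|traces e (~: (A p :|: A x))| <= M ->
  exists2 t, yields merge_ [env graph e; it x; it p] (item (A p :|: A x) t p) &
    exists2 f, represents t f & table_ok e (A p :|: A x) f.
Proof.
move=> rf1 rf2 ok1 ok2 dj M1 M2 M3.
have [t Et [rt _]] := join_spec VL rf1 rf2 (table_ok_small ok1) (table_ok_small ok2) L0 M1 M2 M3.
exists t; last first.
  eexists; first exact: rt.
  by apply: join_table_ok => //; apply: mem_trace_list.
rewrite /merge_ /row_of /set_of /table_of /it /item.
by ev; [apply: union_spec|apply: Et].
Qed.

End Items.

(** * Correctness of the run on a rooted tree *)

Section Run.
Variables (r : T) (par : T -> T) (dep : T -> nat) (l : V -> T) (k : nat).
Hypotheses (e_sym : symmetric e) (sT : symmetric eT).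
Hypotheses (rT : rooted eT r par dep) (leaf_l : forall v, leaf eT (l v)).
Hypotheses (l_inj : injective l) (deg3 : forall x, degree eT x <= 3).
Hypothesis narrow_below : forall x, x != r -> narrow e k (below par l x).
Hypothesis Mk : M = 2 ^ k.

Notation partial := (partial r par l).

Lemma narrow_partialM W x : narrow e k (partial W x).
Proof. exact: (narrow_partial sT rT leaf_l deg3 narrow_below). Qed.

Lemma tracesM A : narrow e k A -> #|traces e A| <= M.
Proof. by rewrite Mk => /andP[]. Qed.

Lemma tracesCM A : narrow e k A -> #|traces e (~: A)| <= M.
Proof. by rewrite Mk => /andP[]. Qed.

(* The state of the computation when the nodes in [W] are active. *)
Definition state (W : seq T) (d : data) : Prop :=
  exists tt : T -> data,
    d = enc_seq [seq item (partial [set y in W] x) (tt x) x | x <- W] /\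
    forall x, x \in W -> exists2 f, represents (tt x) f &
                                   table_ok e (partial [set y in W] x) f.

Lemma step_spec W d : size W <= L -> active r par W -> state W d ->
  exists2 d', yields step_ [env graph e; d] d' &
    exists W', [/\ active r par W', state W' d' & size W' <= maxn 1 (size W).-1].
Proof.
move=> sz aW [tt [-> ttW]]; pose it x := item (partial [set y in W] x) (tt x) x.
have Ecand := @candidate_spec (partial [set y in W]) tt W sz.
case: (candidateP (partial [set y in W]) tt W (behead W)) => [[cN noc]|].
  exists (enc_seq (map it W)).
    by eapply yields_let; [ev; apply: Ecand|rewrite cN; eapply yields_if_nil; ev].
  exists W; split=> //; first by exists tt.
  rewrite leq_max; have [//|W1] /= := leqP (size W) 1.
  have [x xW nx] := active_merge_ex rT aW W1.
  by have := noc x xW; rewrite nx.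
case=> x [p [xW ep cE]].
have [xW0 xr epx cx aW'] := active_merge sT rT aW xW ep.
have pW : p \in W.
  by have := mem_head p [::]; rewrite -ep mem_filter => /andP[].
have xin : x \in [set y in W] by rewrite inE.
have [eP dP] := partial_merge rT l xin xr cx; rewrite -epx in eP dP.
have [f1 rf1 ok1] := ttW p pW; have [f2 rf2 ok2] := ttW x xW0.
have nU : narrow e k (partial [set y in W] p :|: partial [set y in W] x).
  by rewrite -eP; apply: narrow_partialM.
have [t Et [f rf okf]] := @merge_spec (partial [set y in W]) tt x p f1 f2 rf1 rf2 ok1 ok2 dP
  (tracesM (narrow_partialM _ _)) (tracesM (narrow_partialM _ _)) (tracesCM nU).
have Erep := @replace_spec (partial [set y in W]) tt W x p
  (partial [set y in W] p :|: partial [set y in W] x) t sz.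
eexists.
  eapply yields_let; first by ev; apply: Ecand.
  rewrite cE; eapply yields_if_cons; first by ev.
  by ev; [apply: Et|apply: Erep].
have eW' : [set y in [seq y <- W | y != x]] = [set y in W] :\ x.
  by apply/setP=> y; rewrite !inE mem_filter.
exists [seq y <- W | y != x]; split=> //.
  exists (fun y => if y == p then t else tt y); split.
    congr enc_seq; apply/eq_in_map => y _; rewrite eW'.
    case: eqVneq => [->|yp]; first by rewrite eP.
    by rewrite partial_other // -epx.
  move=> y; rewrite mem_filter => /andP[yx yW]; rewrite eW'.
  case: eqVneq => [->|yp]; first by exists f; rewrite // eP.
  by rewrite partial_other -?epx //; apply: ttW.
rewrite leq_max; apply/orP; right.
have [uW _ _] := aW; have := count_predC (pred1 x) W.
by rewrite count_uniq_mem // xW0 size_filter => <-.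
Qed.

(** The leaf encoding in terms of [l], the inverse of [delta] read as a map into [T]; [leaf_codeE]
    identifies it with [enc_leaves]. *)
Definition leaf_code (x : T) : data :=
  if [pick v | l v == x] is Some v then Cons Nil (enc_nat (enum_rank v)) else Nil.

Lemma own_card x : #|own l x| <= 1.
Proof.
apply/card_le1_eqP=> u v; rewrite !inE => /eqP <- /eqP H.
by apply: l_inj.
Qed.

Lemma items_spec :
  exists2 d, yields items_ [env graph e; enc_graph eT; enc_seq [seq leaf_code x | x <- enum T]] d &
    state (enum T) d.
Proof.
have szT : size (enum T) <= L by rewrite -cardE.
have eWT : [set y in enum T] = setT by apply/setP=> y; rewrite !inE mem_enum.
(* Programs are deterministic, so the tables provided by [init_spec] for the single nodes are
   collected into one function through [den]. *)
pose tt x := den init_ [env graph e; bits (own l x)].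
have init x : yields init_ [env graph e; bits (own l x)] (tt x) /\
    tabulates L (init_table e (own l x) (trace_list e (~: own l x))) (tt x).
  have nx : narrow e k (own l x) by rewrite -(partial_setT r par l); apply: narrow_partialM.
  have [t Et tf] := init_spec VL L0 (tracesCM nx).
  have -> : tt x = t by case: Et.
  by [].
exists (enc_seq [seq item (own l x) (tt x) x | x <- enum T]); last first.
  exists tt; rewrite eWT; split=> [|x _].
    by congr enc_seq; apply: eq_map => x; rewrite partial_setT.
  have [_ [rf _]] := init x; eexists; first exact: rf.
  rewrite partial_setT; apply: init_table_ok; [exact: own_card|exact: mem_trace_list].
apply: (yields_fold0 (g := fun x => Cons (enc_nat (index x (enum T))) (Cons (row x) (leaf_code x)))
  (F := fun s => enc_seq [seq item (own l x) (tt x) x | x <- s])) (szT) _; ev.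
- have -> : enc_graph eT = enc_seq [seq row x | x <- enum T] by [].
  by apply: (indices_spec M (s := [seq row x | x <- enum T])); rewrite size_map.
- by apply: zip_spec.
- by rewrite size_map -enc_index_enum; apply: zip_spec.
move=> s1 x s2 _; have [Ei _] := init x.
eapply (yields_let (u := bits (own l x))); last by rewrite /item; ev; apply: Ei.
rewrite /leaf_code; case: pickP => [v /eqP lv|nv].
  have -> : own l x = [set v].
    by apply/setP=> u; rewrite !inE -lv (inj_eq l_inj).
  by eapply yields_if_cons; ev; apply: unit_spec.
have -> : own l x = set0 by apply/setP=> u; rewrite !inE nv.
by eapply yields_if_nil; ev; apply: zeros_set_spec.
Qed.

Lemma solve_spec : (exists W, enum T = r :: W) ->
  yields solve_ [env graph e; enc_graph eT; enc_seq [seq leaf_code x | x <- enum T]]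
    (enc_nat (domination_number e)).
Proof.
move=> er; have szT : size (enum T) <= L by rewrite -cardE.
have [d0 E0 s0] := items_spec.
have [d Ed [W [aW [tt [ed ttW]] sW]]] : exists2 d,
    yields (HFold 0 (call items_ [:: var 0; var 1; var 2]) (var 1) (call step_ [:: var 2; var 1]))
      [env graph e; enc_graph eT; enc_seq [seq leaf_code x | x <- enum T]] d &
    exists W, [/\ active r par W, state W d & size W <= maxn 1 (#|T| - size (enum T))].
  apply: (yields_fold0_ex (g := row) (R := fun s d => exists W,
    [/\ active r par W, state W d & size W <= maxn 1 (#|T| - size s)]) _ _ szT (a := d0)).
  - by ev.
  - by ev; apply: E0.
  - exists (enum T); split=> //; last by rewrite subn0 leq_max -cardE leqnn orbT.
    by split; [exact: enum_uniq|exact: er|move=> x _ _; rewrite mem_enum].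
  move=> s1 x s2 acc es [W [aW sW lW]].
  have szW : size W <= L.
    have [uW _ _] := aW; apply: leq_trans TL; rewrite cardE.
    by apply: uniq_leq_size => // y; rewrite mem_enum.
  have [d' Ed' [W' [aW' sW' lW']]] := step_spec szW aW sW.
  exists d'; first by ev; apply: Ed'.
  exists W'; split=> //; apply: leq_trans lW' _.
  by rewrite geq_max leq_maxl /=; move: lW; rewrite !leq_max /=; lia.
have eW : W = [:: r].
  case: aW => _ [W' eW] _; move: sW; rewrite -cardE subnn maxn0 eW.
  by case: W' {eW}.
have [f rf okf] : exists2 f, represents (tt r) f & table_ok e setT f.
  have := ttW r; rewrite eW inE eqxx => /(_ isT)[f rf okf]; exists f => //.
  rewrite -(below_root rT l) -(@partial_below _ _ _ _ _ rT _ l [set y in [:: r]]) //.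
  rewrite disjoint_subset; apply/subsetP=> c; rewrite !inE => /andP[cr _].
  exact: cr.
eapply yields_let; first exact: Ed.
rewrite ed eW /=.
have get := get_table_spec M VL set0 set0 rf.
rewrite (table_domination e_sym okf) in get.
eapply yields_tl; rewrite /table_of /item; ev.
- exact: zeros_set_spec.
- exact: zeros_set_spec.
- exact: key_spec.
- exact: get.
Qed.

End Run.
End Main.

Lemma leaf_codeE (V T : finType) (eT : rel T) (delta : {x : T | leaf eT x} -> V)
    (g : V -> {x : T | leaf eT x}) : cancel delta g -> cancel g delta ->
  enc_leaves delta = enc_seq [seq leaf_code (fun v => val (g v)) x | x <- enum T].
Proof.
move=> dg gd; congr enc_seq; apply: eq_map => x; rewrite /leaf_code.
case: insubP => [u ux eu|nx].
  case: pickP => [v /eqP ev|/(_ (delta u))]; last by rewrite dg eu eqxx.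
  by rewrite -[u]dg; congr (Cons _ (enc_nat (enum_rank _))); rewrite dg;
     apply: (can_inj gd); rewrite dg; apply: val_inj; rewrite eu.
case: pickP => [v /eqP ev|//].
by move: nx; rewrite -ev (valP (g v)).
Qed.

Lemma side_below (V T : finType) (eT : rel T) (delta : {x : T | leaf eT x} -> V)
    (g : V -> {x : T | leaf eT x}) r par dep x :
  cancel delta g -> cancel g delta -> symmetric eT -> rooted eT r par dep -> x != r ->
  side delta x (par x) = below par (fun v => val (g v)) x.
Proof.
move=> dg gd sT rT xr; apply/setP=> v; rewrite [in RHS]inE -(desc_side sT rT) //.
apply/imsetP/idP=> [[u + ->]|xv]; first by rewrite inE dg.
by exists (g v); rewrite ?inE.
Qed.

(** The entry point has number 0, so the auxiliary functions are numbered from 1. *)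
Definition domination_program : program := (comp 1 main_).1 :: (comp 1 main_).2.

Theorem theorem8 :
  exists (P : program) (C c : nat),
    forall (V T : finType) (e : rel V) (eT : rel T)
           (delta : {x : T | leaf eT x} -> V) (k : nat),
      simple_graph e ->
      branch_decomposition delta ->
      mm_width e delta = k ->
      exists t : nat,
        [/\ runs P (enc_instance e delta) (enc_nat (domination_number e)) t,
            t <= C * 8 ^ k * (#|V| + #|T|) ^ c
          & (forall x : T, degree eT x != 2) -> t <= C * 8 ^ k * #|V| ^ c].
Proof.
(* This [8 ^ depth main_] comes from [L <= 8 * q], used with [q = #|V| + #|T|], and with [q = #|V|]
   when [#|T| <= 3 * #|V|]; it is unrelated to [8 ^ k]. *)
exists domination_program, (coef main_ * 8 ^ depth main_), (depth main_).
(* Found by computation; the three nested loops over traces in [join_] attain it. The numbers are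
   then generalized so that they stay opaque. *)
have w3 : weight main_ <= 3 by [].
move: (coef main_) (depth main_) (weight main_) w3 (cost_le main_) => K D w w3 costM.
move=> V T e eT delta k [e_sym e_irr] [tree deg3 [g dg gd]] wk.
have [[sT iT] T0 _ _] := tree.
have [r er] : exists r, exists W, enum T = r :: W.
  by move: T0; rewrite cardE; case: (enum T) => // r W _; exists r, W.
have [par [dep rT]] := tree_rooted r tree.
(* The doubling accommodates trie keys, made of two characteristic vectors. *)
pose l v := val (g v); pose L := (#|V| + #|T|).*2; pose M := 2 ^ k.
have VL : (#|V|).*2 <= L by rewrite leq_double leq_addr.
have TL : #|T| <= L by rewrite /L -addnn; lia.
have L0 : 0 < L := leq_trans T0 TL.
have leaf_l v : leaf eT (l v) := valP (g v).
have l_inj : injective l by move=> u v /val_inj /(can_inj gd).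
have narrow_below x : x != r -> narrow e k (below par l x).
  move=> xr; rewrite -(side_below dg gd sT rT xr); apply: narrow_mm => //.
  rewrite -wk /mm_width.
  by apply: (leq_bigmax_cond (x, par x) (par_edge rT xr)).
have [okm denm] : yields L M main_ (enc_instance e delta) (enc_nat (domination_number e)).
  rewrite /enc_instance /main_; eapply yields_call; first by cbn [foldr]; ev.
  rewrite -graphE (leaf_codeE dg gd).
  exact: (solve_spec VL TL L0 e_sym sT rT leaf_l l_inj deg3 narrow_below).
have inst : installed domination_program 1 (comp 1 main_).2 by [].
have [t lt Et] := comp_eval inst okm [::].
have {}lt : t <= K * (L ^ D * 8 ^ k).
  have M0 : 0 < M by rewrite expn_gt0.
  apply: leq_trans lt (leq_trans (costM _ _ L0 M0) _).
  (* The power of [M = 2 ^ k] is at most the third, which is [8 ^ k]. *)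
  by rewrite !leq_mul // -[8]/(2 ^ 3) -expnM mulnC expnM leq_pexp2l.
have bound q : L <= 8 * q -> t <= K * 8 ^ D * 8 ^ k * q ^ D.
  move=> Lq; apply: leq_trans lt _; rewrite -!mulnA leq_mul //.
  rewrite mulnCA mulnC leq_mul // -expnMn.
  by case: (D) => // d; rewrite leq_exp2r.
exists t; split; first by rewrite /runs -denm.
  by apply: bound; rewrite /L -mul2n leq_mul2r orbT.
move=> no2; apply: bound.
have leT : #|T| <= 3 * #|V|.
  apply: leq_trans (card_tree_le sT rT no2) _; rewrite leq_mul2l.
  have : #|[set x | leaf eT x]| <= #|codom l|; last by rewrite card_codom.
  (* Each leaf is the image under [l] of the vertex that [delta] assigns to it. *)
  apply/subset_leq_card/subsetP=> x; rewrite inE => lx.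
  apply/codomP; exists (delta (Sub x lx)); by rewrite /l dg.
by rewrite /L -addnn; lia.
Qed.
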